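(* Let $n\ge1$, $\frac{\pi}{4}<\tau<\frac{\pi}{2}$, $a=\cot\tau$ and $b=\sqrt{1-\cot^2\tau}$. Let $u:\mathbb{R}^n\to\mathbb{R}$ be a $C^2$ function such that, denoting by $\lambda_1(x),\dots,\lambda_n(x)$ the eigenvalues of the Hessian $D^2u(x)$, one has $\lambda_i(x)\neq-(a+b)$ for all $x\in\mathbb{R}^n$ and all $i$ (so that the following expression is defined) and $$\frac{\sqrt{a^2+1}}{b}\sum_{i=1}^n\arctan\frac{\lambda_i(x)+a-b}{\lambda_i(x)+a+b}=-u(x)+\frac12\langle x,Du(x)\rangle,\qquad x\in\mathbb{R}^n.$$ Then $u$ is a quadratic polynomial. Furthermore, there exists a symmetric real $n\times n$ matrix $A$ such that $$u(x)=-\frac{\sqrt{a^2+1}}{b}\sum_{i=1}^n\arctan\frac{\bar\lambda_i+a-b}{\bar\lambda_i+a+b}+\frac12\langle x,Ax\rangle\qquad\text{for all }x\in\mathbb{R}^n,$$ where $\bar\lambda_1,\dots,\bar\lambda_n$ are the eigenvalues of $A$.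
   Context: $\langle\cdot,\cdot\rangle$ is the standard inner product on $\mathbb{R}^n$ and $Du$ is the gradient. $\arctan$ takes values in $(-\frac{\pi}{2},\frac{\pi}{2})$. ''Quadratic polynomial'' means a polynomial of degree at most $2$. *)

(* Defs.v *)
From HB Require Import structures.
From mathcomp Require Import all_boot all_order all_algebra.
From mathcomp Require Import all_classical all_reals all_analysis.
(* The notations of mpoly clash with those of MathComp-Analysis. *)
From mathcomp Require Import -(notations) mpoly.
Set Implicit Arguments.
Unset Strict Implicit.
Unset Printing Implicit Defensive.
Import Order.TTheory GRing.Theory Num.Theory.
Import numFieldNormedType.Exports.
Local Open Scope ring_scope.

Definition cot (R : realType) (t : R) : R := cos t / sin t.

(* Vectors of R^n are row vectors throughout. *)
Definition inner (R : realType) (n : nat) (x y : 'rV[R]_n) : R :=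
  \sum_(i < n) x 0 i * y 0 i.

Definition evec (R : realType) (n : nat) (i : 'I_n) : 'rV[R]_n := delta_mx 0 i.

Definition partial (R : realType) (n : nat) (i : 'I_n) (u : 'rV[R]_n -> R) :
  'rV[R]_n -> R := fun x => 'D_(evec R i) u x.

Definition gradient (R : realType) (n : nat) (u : 'rV[R]_n -> R)
  (x : 'rV[R]_n) : 'rV[R]_n := \row_(i < n) partial i u x.

Definition hessian (R : realType) (n : nat) (u : 'rV[R]_n -> R)
  (x : 'rV[R]_n) : 'M[R]_n :=
  \matrix_(i < n, j < n) partial i (partial j u) x.

(* ['D_v u x] is a limit that is total in MathComp-Analysis, so the existence
   of the partial derivatives has to be asserted separately. *)
Definition C1 (R : realType) (n : nat) (u : 'rV[R]_n -> R) : Prop :=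
  forall i : 'I_n,
    (forall x, derivable u x (evec R i)) /\ continuous (partial i u).

Definition C2 (R : realType) (n : nat) (u : 'rV[R]_n -> R) : Prop :=
  [/\ continuous u, C1 u & forall i : 'I_n, C1 (partial i u)].

(* [l] lists the eigenvalues of [A] with algebraic multiplicity, in any order. *)
Definition eigenvalues_of (R : realType) (n : nat) (A : 'M[R]_n)
  (l : 'I_n -> R) : Prop :=
  char_poly A = \prod_(i < n) ('X - (l i)%:P).

Definition phase (R : realType) (n : nat) (a b : R) (l : 'I_n -> R) : R :=
  Num.sqrt (a ^+ 2 + 1) / b *
  \sum_(i < n) atan ((l i + a - b) / (l i + a + b)).

(* [mmeasure mdeg p] is the total degree of [p] plus one (and 0 for [p = 0]). *)
Definition quadratic_polynomial (R : realType) (n : nat)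
  (u : 'rV[R]_n -> R) : Prop :=
  exists2 p : mpoly n R, (mmeasure mdeg p <= 3)%N &
    forall x, u x = meval (fun i => x 0 i) p.

(* Main.v *)
(** Write [phi = - u + <x, Du> / 2]. The numbers of eigenvalues on either side of
    the pole [- (a + b)] cannot jump, because both [phi] and the sum of the
    [atan ((lambda_i + a) / b)] are continuous; hence the equation reads
    [tr f (D^2 u) = phi + const] with [f] smooth, bounded and increasing.

    [phi] is half the derivative at [t = 0] of the dilations [e^(-2t) u (e^t x)].
    As [u] is only C^2, the linearized equation [tr (f' (D^2 u) D^2 phi) =
    <x, D phi> / 2] makes no sense pointwise, and the maximum principle is applied to
    [q = (e^(-2d) u (e^d x) - u x) / (2d)] instead. It is C^2, it is bounded because
    it equals [e^(-2s) phi (e^s x)] for some [s] in [(0, d)], and its Hessian is an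
    exact difference of two Hessians of [u]. If [phi] exceeds [phi 0] somewhere, then
    [q + ep * H] with [H = e^(- al |x|^2) - ka |x|^2] has a maximum away from the
    origin, where [H] is a strict subsolution; the comparison of the two Hessians
    there fails for small [d]. Thus [phi <= phi 0], and [- u] gives the converse.

    Since [phi] is constant, [u - u 0] is homogeneous of degree 2, and a C^2 function
    with this property is a quadratic form. *)
Require Import Defs.
From HB Require Import structures.
From mathcomp Require Import all_boot all_order all_algebra.
From mathcomp Require Import all_classical all_reals all_analysis.
From mathcomp Require Import -(notations) mpoly.
From mathcomp Require Import ring lra.
Import Order.TTheory GRing.Theory Num.Theory.
Import numFieldNormedType.Exports.
Local Open Scope ring_scope.
Set Implicit Arguments.
Unset Strict Implicit.

(** * Linear algebra *)

Section InnerProduct.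
Local Open Scope classical_set_scope.
Context {R : realType}.
Implicit Types n : nat.

Lemma innerE n (x y : 'rV[R]_n) : inner x y = (x *m y^T) 0 0.
Proof. by rewrite mxE; apply: eq_bigr => i _; rewrite mxE. Qed.

Lemma innerC n (x y : 'rV[R]_n) : inner x y = inner y x.
Proof. by apply: eq_bigr => i _; rewrite mulrC. Qed.

Lemma innerDl n (x y z : 'rV[R]_n) : inner (x + y) z = inner x z + inner y z.
Proof. by rewrite !innerE mulmxDl mxE. Qed.

Lemma innerZl n c (x y : 'rV[R]_n) : inner (c *: x) y = c * inner x y.
Proof. by rewrite !innerE -scalemxAl mxE. Qed.

Lemma innerDr n (x y z : 'rV[R]_n) : inner z (x + y) = inner z x + inner z y.
Proof. by rewrite innerC innerDl !(innerC z). Qed.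

Lemma innerZr n c (x y : 'rV[R]_n) : inner x (c *: y) = c * inner x y.
Proof. by rewrite innerC innerZl innerC. Qed.

Lemma innerNl n (x y : 'rV[R]_n) : inner (- x) y = - inner x y.
Proof. by rewrite -scaleN1r innerZl mulN1r. Qed.

Lemma innerBl n (x y z : 'rV[R]_n) : inner (x - y) z = inner x z - inner y z.
Proof. by rewrite innerDl innerNl. Qed.

Lemma innerBr n (x y z : 'rV[R]_n) : inner z (x - y) = inner z x - inner z y.
Proof. by rewrite innerC innerBl !(innerC z). Qed.

Lemma inner_mulr n (x y : 'rV[R]_n) (A : 'M[R]_n) :
  inner (x *m A) y = inner x (y *m A^T).
Proof. by rewrite !innerE trmx_mul trmxK mulmxA. Qed.

Lemma inner_ge0 n (x : 'rV[R]_n) : 0 <= inner x x.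
Proof. by apply: sumr_ge0 => i _; rewrite -expr2 sqr_ge0. Qed.

Lemma inner0l n (x : 'rV[R]_n) : inner 0 x = 0.
Proof. by rewrite innerE mul0mx mxE. Qed.

Lemma inner_eq0 n (x : 'rV[R]_n) : (inner x x == 0) = (x == 0).
Proof.
apply/idP/eqP => [|->]; last by rewrite inner0l.
rewrite psumr_eq0 => [/allP x0|i _]; last by rewrite -expr2 sqr_ge0.
apply/rowP => i; have := x0 i (mem_index_enum _).
by rewrite mxE -expr2 sqrf_eq0 => /eqP.
Qed.

Lemma coord_sqr_le n (x : 'rV[R]_n) i : x 0 i ^+ 2 <= inner x x.
Proof.
rewrite /inner (bigD1 i) //= expr2 lerDl.
by apply: sumr_ge0 => j _; rewrite -expr2 sqr_ge0.
Qed.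

Lemma continuous_add (T : topologicalType) (f g : T -> R) :
  continuous f -> continuous g -> continuous (fun x => f x + g x).
Proof. by move=> fc gc x; apply: continuousD; [exact: fc|exact: gc]. Qed.

Lemma continuous_opp (T : topologicalType) (f : T -> R) :
  continuous f -> continuous (fun x => - f x).
Proof. by move=> fc x; apply: continuousN; exact: fc. Qed.

Lemma continuous_mul (T : topologicalType) (f g : T -> R) :
  continuous f -> continuous g -> continuous (fun x => f x * g x).
Proof. by move=> fc gc x; apply: continuousM; [exact: fc|exact: gc]. Qed.

Lemma continuous_comp_all (S T U : topologicalType) (f : S -> T) (g : T -> U) :
  continuous f -> continuous g -> continuous (fun x => g (f x)).
Proof. by move=> fc gc x; apply: continuous_comp; [exact: fc|exact: gc]. Qed.

Lemma continuous_sum (T : topologicalType) (I : Type) (s : seq I)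
    (F : I -> T -> R) :
  (forall i, continuous (F i)) -> continuous (fun x => \sum_(i <- s) F i x).
Proof.
move=> Fc x; elim: s => [|i s IH].
  rewrite (_ : (fun _ => _) = cst 0) ?funeqE; first exact: cst_continuous.
  by move=> y; rewrite big_nil.
rewrite (_ : (fun _ => _) = (F i \+ fun y => \sum_(j <- s) F j y)).
  by apply: continuousD => //; apply: Fc.
by apply/funext => y; rewrite big_cons.
Qed.

Lemma continuous_coord n (i : 'I_n) : continuous (fun x : 'rV[R]_n => x 0 i).
Proof. exact: coord_continuous. Qed.

Lemma continuous_inner (T : topologicalType) n (F G : T -> 'rV[R]_n) :
  (forall i, continuous (fun x => F x 0 i)) ->
  (forall i, continuous (fun x => G x 0 i)) ->
  continuous (fun x => inner (F x) (G x)).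
Proof.
by move=> Fc Gc; apply: continuous_sum => i x; apply: continuousM; [exact: Fc|exact: Gc].
Qed.

Lemma continuous_coord_mulmx n m (A : 'M[R]_(n, m)) i :
  continuous (fun x : 'rV[R]_n => (x *m A) 0 i).
Proof.
rewrite (_ : (fun _ => _) = fun x : 'rV[R]_n => \sum_j x 0 j * A j i); last first.
  by apply/funext => x; rewrite mxE.
apply: continuous_sum => j x; apply: continuousM; first exact: continuous_coord.
exact: cst_continuous.
Qed.

Lemma compact_inner_ball n (r : R) : compact [set x : 'rV[R]_n | inner x x <= r].
Proof.
apply: bounded_closed_compact.
  exists (`|r| + 1); split; first exact: num_real.
  move=> M Mr x /= xr; have M0 : 0 <= M by apply: le_trans (ltW Mr); rewrite addr_ge0.
  rewrite /Num.norm /= mx_normrE; apply/bigmax_leP; split => //= -[i j] _ /=.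
  rewrite (ord1 i) -(@ler_pXn2r _ 2) ?nnegrE // -normrX ger0_norm ?sqr_ge0 //.
  apply: le_trans (coord_sqr_le x j) _; apply: le_trans xr _.
  have := ler_norm r; nra.
have -> : [set x : 'rV[R]_n | inner x x <= r] = (fun x => inner x x) @^-1` [set y | y <= r] by [].
apply: closed_comp => [x _|]; last exact: closed_le.
by apply: continuous_inner => i; exact: continuous_coord.
Qed.

End InnerProduct.

Section Spectral.
Local Open Scope classical_set_scope.
Context {R : realType}.
Implicit Types n : nat.

Lemma rayleigh_max n (A : 'M[R]_n.+1) :
  exists2 v : 'rV[R]_n.+1, inner v v = 1 &
    forall w, inner (w *m A) w <= inner (v *m A) v * inner w w.
Proof.
have e1 : inner (delta_mx 0 0 : 'rV[R]_n.+1) (delta_mx 0 0) = 1.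
  rewrite /inner (bigD1 0) //= big1 ?mxE ?addr0 ?mulr1 //.
  by move=> i i0; rewrite !mxE (negbTE i0) mulr0.
pose S := [set x : 'rV[R]_n.+1 | inner x x = 1].
have Sc : compact S.
  have -> : S = [set x | inner x x <= 1] `&` [set x | 1 <= inner x x].
    apply/seteqP; split=> x /=; first by move=> ->.
    by move=> [x1 x2]; apply/eqP; rewrite eq_le x1.
  apply: compact_closedI; first exact: compact_inner_ball.
  have -> : [set x : 'rV[R]_n.+1 | 1 <= inner x x] =
      (fun x => inner x x) @^-1` [set y | 1 <= y] by [].
  apply: closed_comp => [x _|]; last exact: closed_ge.
  by apply: continuous_inner => i; exact: continuous_coord.
have [||v] := @EVT_max_rV R _ (fun w => inner (w *m A) w) S _ Sc.
- by exists (delta_mx 0 0).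
- apply: continuous_subspaceT.
  by apply: continuous_inner => i; [exact: continuous_coord_mulmx|exact: continuous_coord].
rewrite inE => v1 vmax; exists v => // w.
have [->|w0] := eqVneq w 0; first by rewrite mul0mx !inner0l mulr0.
have w_gt0 : 0 < inner w w by rewrite lt_def inner_eq0 w0 inner_ge0.
have := vmax (Num.sqrt (inner w w)^-1 *: w).
rewrite inE /S /= -scalemxAl !innerZl !innerZr !mulrA -expr2 sqr_sqrtr ?invr_ge0 ?(ltW w_gt0) //.
by rewrite mulVf ?gt_eqF // => /(_ erefl); rewrite ler_pdivrMl // mulrC.
Qed.

Lemma symmetric_eigenvector n (A : 'M[R]_n.+1) : A^T = A ->
  exists (v : 'rV[R]_n.+1) (l : R), inner v v = 1 /\ v *m A = l *: v.
Proof.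
move=> As; have [v v1 vmax] := rayleigh_max A.
exists v, (inner (v *m A) v); split=> //; set l := inner (v *m A) v.
apply/eqP; rewrite -subr_eq0; set z := v *m A - l *: v.
have vz : inner v z = 0 by rewrite innerBr innerZr v1 innerC -/l mulr1 subrr.
have zA : inner (v *m A) z = inner z z.
  by rewrite -[v *m A](subrK (l *: v)) -/z innerDl innerZl vz mulr0 addr0.
rewrite -inner_eq0; apply/eqP; clearbody z.
set c := inner (z *m A) z - l * inner z z.
have key t : 2 * t * inner z z + t ^+ 2 * c <= 0.
  have := vmax (v + t *: z); rewrite -/l mulmxDl -scalemxAl.
  rewrite !(innerDl, innerDr, innerZl, innerZr) -/l.
  rewrite (innerC z v) vz v1 zA inner_mulr As (innerC z) zA /c => H.
  rewrite -subr_le0; move: H; rewrite -subr_le0.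
  set X := (X in X <= 0) => H; set Y := (Y in Y <= 0); suff -> : Y = X by [].
  by rewrite /X /Y; ring.
apply/eqP; rewrite eq_le inner_ge0 andbT leNgt; apply/negP => z0.
have c1 : 0 < `|c| + 1 by rewrite ltr_wpDl.
have := key (inner z z / (`|c| + 1)).
set q := inner z z / (`|c| + 1); have q0 : 0 < q by rewrite divr_gt0.
have -> : inner z z = q * (`|c| + 1) by rewrite mulfVK // gt_eqF.
have := ler_norm (- c); rewrite normrN => cn.
apply/negP; rewrite -ltNge.
have -> : 2 * q * (q * (`|c| + 1)) + q ^+ 2 * c = q ^+ 2 * (2 * (`|c| + 1) + c) by ring.
by apply: mulr_gt0; [rewrite exprn_gt0|lra].
Qed.

Lemma reflection_to_delta n (v : 'rV[R]_n.+1) : inner v v = 1 ->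
  exists Q : 'M[R]_n.+1, [/\ Q^T = Q, Q *m Q = 1%:M & delta_mx 0 0 *m Q = v].
Proof.
move=> v1; set e : 'rV[R]_n.+1 := delta_mx 0 0.
have e1 : inner e e = 1.
  rewrite /inner (bigD1 0) //= big1 ?mxE ?addr0 ?mulr1 //.
  by move=> i i0; rewrite !mxE (negbTE i0) mulr0.
have [->|ve] := eqVneq v e.
  by exists 1%:M; rewrite trmx1 !mulmx1.
pose w := v - e.
have w0 : inner w w != 0 by rewrite inner_eq0 subr_eq0.
have rank1 (x : 'rV[R]_n.+1) : x *m (w^T *m w) = inner x w *: w.
  by rewrite mulmxA [x *m w^T]mx11_scalar mul_scalar_mx innerE.
pose P := w^T *m w.
have PP : P *m P = inner w w *: P.
  by rewrite /P -mulmxA rank1 -scalemxAr.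
(* Householder's reflection exchanging [v] and [e]. *)
exists (1%:M - (2 / inner w w) *: P); split.
- by rewrite linearB /= linearZ /= trmx1 /P trmx_mul trmxK.
- rewrite mulmxBr mulmx1 mulmxBl mul1mx -scalemxAr -scalemxAl PP.
  rewrite !scalerA; set k := 2 / inner w w.
  have -> : k * k * inner w w = k + k by rewrite /k; field.
  by rewrite scalerDl opprB addrK subrK.
- rewrite mulmxBr mulmx1 -scalemxAr rank1 scalerA.
  have -> : inner w w = - 2 * inner e w.
    by rewrite /w !(innerBl, innerBr) v1 e1 (innerC e v); ring.
  have ew : inner e w != 0.
    apply: contraNneq w0; rewrite /w !(innerBl, innerBr) v1 e1 (innerC e v) => ?.
    by apply/eqP; lra.
  have -> : 2 / (-2 * inner e w) * inner e w = -1 by field.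
  by rewrite scaleN1r opprK /w addrC subrK.
Qed.

Lemma spectral_theorem n (A : 'M[R]_n) : A^T = A ->
  exists (Q : 'M[R]_n) (l : 'rV[R]_n), Q *m Q^T = 1%:M /\ A = Q^T *m diag_mx l *m Q.
Proof.
elim: n A => [A _|n IH A As].
  by exists 1%:M, 0; split; apply/matrixP => -[].
have [v [l [v1 vA]]] := symmetric_eigenvector As.
have [H [Hs HH Hv]] := reflection_to_delta v1.
pose M : 'M[R]_(1 + n) := H *m A *m H.
have Ms : M^T = M by rewrite /M !trmx_mul Hs As mulmxA.
have vH : v *m H = delta_mx 0 0 by rewrite -Hv -mulmxA HH mulmx1.
have M0 : row 0 M = l *: delta_mx 0 0.
  by rewrite rowE /M !mulmxA Hv vA -scalemxAl vH.
have Mu : ursubmx M = 0.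
  apply/matrixP => i j; rewrite !mxE (ord1 i) lshift0.
  by have /rowP/(_ (rshift 1 j)) := M0; rewrite !mxE /= mulr0.
have Md : dlsubmx M = 0 by rewrite -[M]trmxK -trmx_ursub Ms Mu trmx0.
have Mul : ulsubmx M = l%:M.
  apply/matrixP => i j; rewrite !mxE (ord1 i) (ord1 j) lshift0.
  by have /rowP/(_ 0) := M0; rewrite !mxE /= mulr1.
have [Q' [l' [QQ' A']]] := IH (drsubmx M) ltac:(by rewrite trmx_drsub Ms).
pose Q1 : 'M[R]_(1 + n) := block_mx 1%:M 0 0 Q'.
have QQ1 : Q1 *m Q1^T = 1%:M.
  rewrite tr_block_mx mulmx_block !trmx0 trmx1 !mulmx0 !mul0mx !mulmx1 addr0 add0r.
  by rewrite QQ' !add0r -scalar_mx_block.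
have MQ : M = Q1^T *m diag_mx (row_mx l%:M l') *m Q1.
  rewrite -[LHS](@submxK _ 1 n 1 n M) Mu Md Mul A' diag_mx_row /Q1 tr_block_mx !mulmx_block.
  rewrite !trmx0 trmx1 !mulmx0 !mul0mx !mulmx1 !mul1mx !addr0 !add0r !mul0mx.
  congr block_mx; apply/matrixP => i j.
  by rewrite !mxE (ord1 i) (ord1 j).
exists (Q1 *m H), (row_mx l%:M l'); split.
  by rewrite trmx_mul Hs mulmxA -(mulmxA Q1 H H) HH mulmx1 QQ1.
have -> : A = H *m M *m H.
  by rewrite /M !mulmxA HH mul1mx -mulmxA HH mulmx1.
by rewrite MQ trmx_mul Hs !mulmxA.
Qed.

End Spectral.

Section TraceFunctions.
Local Open Scope classical_set_scope.
Context {R : realType}.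
Implicit Types n : nat.

Definition frob n (M : 'M[R]_n) : R := \sum_i \sum_j M i j ^+ 2.

Lemma frob_trace n (M : 'M[R]_n) : frob M = \tr (M *m M^T).
Proof.
by apply: eq_bigr => i _; rewrite mxE; apply: eq_bigr => j _; rewrite mxE expr2.
Qed.

Lemma frobZ n c (M : 'M[R]_n) : frob (c *: M) = c ^+ 2 * frob M.
Proof.
rewrite !frob_trace linearZ /= -scalemxAl -scalemxAr scalerA -expr2.
by rewrite mxtraceZ.
Qed.

Lemma frob_ge0 n (M : 'M[R]_n) : 0 <= frob M.
Proof. by apply: sumr_ge0 => i _; apply: sumr_ge0 => j _; exact: sqr_ge0. Qed.

Definition diagonalizes n (Q : 'M[R]_n) (l : 'I_n -> R) (A : 'M[R]_n) : Prop :=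
  Q *m Q^T = 1%:M /\ A = Q^T *m diag_mx (\row_i l i) *m Q.

Lemma char_poly_similar n (Q D : 'M[R]_n) : Q *m Q^T = 1%:M ->
  char_poly (Q^T *m D *m Q) = char_poly D.
Proof.
move=> QQ; have QQ' := mulmx1C QQ.
rewrite /char_poly /char_poly_mx.
have -> : 'X%:M - map_mx polyC (Q^T *m D *m Q) =
    map_mx polyC Q^T *m ('X%:M - map_mx polyC D) *m map_mx polyC Q.
  rewrite mulmxBr mulmxBl -!map_mxM; congr (_ - _).
  by rewrite mul_mx_scalar -scalemxAl -map_mxM QQ' map_mx1 scalemx1.
rewrite !det_mulmx mulrC mulrA -det_mulmx -map_mxM QQ.
by rewrite map_mx1 det1 mul1r.
Qed.

Lemma diagonalizes_eigenvalues n (Q : 'M[R]_n) l A :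
  diagonalizes Q l A -> eigenvalues_of A l.
Proof.
move=> [QQ ->]; rewrite /eigenvalues_of char_poly_similar // char_poly_trig.
  by apply: eq_bigr => i _; rewrite !mxE eqxx mulr1n.
exact/diag_mx_is_trig.
Qed.

Lemma symmetric_diagonalizes n (A : 'M[R]_n) : A^T = A ->
  exists Q l, diagonalizes Q l A.
Proof.
move=> /spectral_theorem [Q [l [QQ ->]]]; exists Q, (l 0); split=> //.
by congr (_ *m diag_mx _ *m _); apply/rowP => i; rewrite mxE.
Qed.

Lemma eigenvalues_sum n (A : 'M[R]_n) l m (h : R -> R) :
  eigenvalues_of A l -> eigenvalues_of A m -> \sum_i h (l i) = \sum_i h (m i).
Proof.
rewrite /eigenvalues_of => -> lm.
have : perm_eq [seq l i | i <- index_enum 'I_n] [seq m i | i <- index_enum 'I_n].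
  by apply: prod_XsubC_eq; rewrite !big_map.
by move=> lm'; rewrite -(big_map l xpredT h) -(big_map m xpredT h); exact: perm_big.
Qed.

Lemma spectral_coupling n (A B P Q : 'M[R]_n) l m :
  diagonalizes Q l A -> diagonalizes P m B ->
  exists T : 'M[R]_n,
    [/\ forall i, \sum_j T i j ^+ 2 = 1,
        forall j, \sum_i T i j ^+ 2 = 1,
        forall j, inner (row j Q *m (B - A)) (row j Q) =
                  \sum_i T i j ^+ 2 * (m i - l j) &
        \sum_i \sum_j T i j ^+ 2 * (m i - l j) ^+ 2 = frob (B - A)].
Proof.
move=> [QQ AE] [PP BE]; have QQ' := mulmx1C QQ; have PP' := mulmx1C PP.
pose T := P *m Q^T; exists T.
pose W := P *m (B - A) *m Q^T.
have WE i j : W i j = (m i - l j) * T i j.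
  have -> : W = diag_mx (\row_i m i) *m T - T *m diag_mx (\row_i l i).
    rewrite /W mulmxBr mulmxBl AE BE /T !mulmxA PP mul1mx; congr (_ - _).
    by rewrite -!mulmxA QQ mulmx1.
  rewrite mul_diag_mx mul_mx_diag !mxE; ring.
have TT : T *m T^T = 1%:M.
  by rewrite /T trmx_mul trmxK !mulmxA -(mulmxA P Q^T Q) QQ' mulmx1 PP.
have TT' := mulmx1C TT.
split=> [i|j|j|].
- have /matrixP/(_ i i) := TT; rewrite mxE [RHS]mxE eqxx mulr1n => <-.
  by apply: eq_bigr => j _; rewrite [T^T _ _]mxE expr2.
- have /matrixP/(_ j j) := TT'; rewrite mxE [RHS]mxE eqxx mulr1n => <-.
  by apply: eq_bigr => i _; rewrite [T^T _ _]mxE expr2.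
- have -> : inner (row j Q *m (B - A)) (row j Q) = (T^T *m W) j j.
    have -> : T^T *m W = Q *m (B - A) *m Q^T.
      by rewrite /T /W trmx_mul trmxK !mulmxA -(mulmxA Q P^T P) PP' mulmx1.
    rewrite innerE -row_mul mxE [RHS]mxE.
    by apply: eq_bigr => k _; rewrite !mxE.
  rewrite mxE; apply: eq_bigr => i _; rewrite WE [T^T _ _]mxE expr2; ring.
- have <- : frob W = frob (B - A).
    rewrite !frob_trace /W !trmx_mul trmxK !mulmxA -(mulmxA _ Q^T) QQ' mulmx1.
    by rewrite mxtrace_mulC !mulmxA PP' mul1mx.
  apply: eq_bigr => i _; apply: eq_bigr => j _; rewrite WE; ring.
Qed.

Lemma coupling_sum n (T : 'M[R]_n) (p q : 'I_n -> R) :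
  (forall i, \sum_j T i j ^+ 2 = 1) -> (forall j, \sum_i T i j ^+ 2 = 1) ->
  \sum_i p i - \sum_j q j = \sum_i \sum_j T i j ^+ 2 * (p i - q j).
Proof.
move=> T1 T2.
have -> : \sum_i p i = \sum_i \sum_j T i j ^+ 2 * p i.
  by apply: eq_bigr => i _; rewrite -mulr_suml T1 mul1r.
have -> : \sum_j q j = \sum_i \sum_j T i j ^+ 2 * q j.
  by rewrite exchange_big; apply: eq_bigr => i _; rewrite -mulr_suml T2 mul1r.
rewrite -sumrB; apply: eq_bigr => i _; rewrite -sumrB.
by apply: eq_bigr => j _; rewrite mulrBr.
Qed.

Lemma trace_taylor n (f g : R -> R) (C : R) (A B P Q : 'M[R]_n) l m :
  (forall x y, `|f y - f x - g x * (y - x)| <= C * (y - x) ^+ 2) ->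
  diagonalizes Q l A -> diagonalizes P m B ->
  `|\sum_i f (m i) - \sum_i f (l i) -
    \sum_j g (l j) * inner (row j Q *m (B - A)) (row j Q)| <= C * frob (B - A).
Proof.
move=> fg dA dB; have [T [T1 T2 T3 <-]] := spectral_coupling dA dB.
rewrite (coupling_sum (fun i => f (m i)) (fun i => f (l i)) T1 T2).
have -> : \sum_j g (l j) * inner (row j Q *m (B - A)) (row j Q) =
    \sum_i \sum_j T i j ^+ 2 * (g (l j) * (m i - l j)).
  rewrite exchange_big; apply: eq_bigr => j _; rewrite T3 mulr_sumr.
  by apply: eq_bigr => i _; ring.
rewrite -sumrB mulr_sumr; apply: le_trans (ler_norm_sum _ _ _) _.
apply: ler_sum => i _; rewrite -sumrB mulr_sumr.
apply: le_trans (ler_norm_sum _ _ _) _; apply: ler_sum => j _.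
rewrite -mulrBr normrM (ger0_norm (sqr_ge0 _)) mulrCA ler_wpM2l ?sqr_ge0 //.
Qed.

Lemma trace_lipschitz n (f : R -> R) (C d : R) (A B : 'M[R]_n) l m :
  A^T = A -> B^T = B -> eigenvalues_of A l -> eigenvalues_of B m ->
  (forall x y, `|f y - f x| <= C * `|y - x|) -> 0 < d ->
  `|\sum_i f (m i) - \sum_i f (l i)| <= C * (n%:R * d + frob (B - A) / d).
Proof.
move=> /symmetric_diagonalizes [Q [l' dA]] /symmetric_diagonalizes [P [m' dB]].
move=> /(eigenvalues_sum f (diagonalizes_eigenvalues dA)) <-.
move=> /(eigenvalues_sum f (diagonalizes_eigenvalues dB)) <- fl d0.
have [T [T1 T2 T3 <-]] := spectral_coupling dA dB.
rewrite (coupling_sum (fun i => f (m' i)) (fun i => f (l' i)) T1 T2).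
have C0 : 0 <= C by have := fl 0 1; rewrite subr0 normr1 mulr1; apply: le_trans.
have -> : n%:R * d = \sum_i \sum_j T i j ^+ 2 * d.
  under eq_bigr => i _ do rewrite -mulr_suml T1 mul1r.
  by rewrite sumr_const card_ord mulr_natl.
rewrite mulr_suml -big_split mulr_sumr; apply: le_trans (ler_norm_sum _ _ _) _.
apply: ler_sum => i _; rewrite mulr_suml -big_split mulr_sumr.
apply: le_trans (ler_norm_sum _ _ _) _; apply: ler_sum => j _ /=.
rewrite normrM (ger0_norm (sqr_ge0 _)) -mulrA -mulrDr mulrCA.
rewrite ler_wpM2l ?sqr_ge0 //; apply: le_trans (fl _ _) _; rewrite ler_wpM2l //.
set x := m' i - l' j; rewrite -(ler_pM2r d0) mulrDl divfK ?gt_eqF //.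
rewrite -(@real_normK _ x) ?num_real //; have := normr_ge0 x.
have := sqr_ge0 (d - `|x|); nra.
Qed.


Lemma row_orthonormal n (Q : 'M[R]_n) j : Q *m Q^T = 1%:M ->
  inner (row j Q) (row j Q) = 1.
Proof.
move=> /matrixP/(_ j j); rewrite mxE [RHS]mxE eqxx mulr1n => <-.
by apply: eq_bigr => k _; rewrite !mxE.
Qed.

Lemma inner_orthonormal_basis n (Q : 'M[R]_n) (y : 'rV[R]_n) : Q *m Q^T = 1%:M ->
  \sum_j inner y (row j Q) ^+ 2 = inner y y.
Proof.
move=> QQ; rewrite [RHS]innerE.
have -> : y *m y^T = y *m Q^T *m (y *m Q^T)^T.
  by rewrite trmx_mul trmxK !mulmxA -(mulmxA y Q^T Q) (mulmx1C QQ) mulmx1.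
rewrite mxE; apply: eq_bigr => j _; rewrite [_^T _ _]mxE -expr2; congr (_ ^+ 2).
by rewrite mxE; apply: eq_bigr => k _; rewrite !mxE.
Qed.

Lemma nondecreasing_of_quadratic_defect (h : R -> R) (D : R) :
  (forall s t, s <= t -> h s - D * (t - s) ^+ 2 <= h t) -> h 0 <= h 1.
Proof.
move=> hD; rewrite leNgt; apply/negP => h10.
have step (N : nat) k : (k <= N.+1)%N ->
    h 0 - k%:R * (D / N.+1%:R ^+ 2) <= h (k%:R / N.+1%:R).
  have N0 : (0 : R) < N.+1%:R by rewrite ltr0n.
  elim: k => [_|k IH kN]; first by rewrite !mul0r subr0.
  have := hD (k%:R / N.+1%:R) (k.+1%:R / N.+1%:R).
  rewrite ler_pM2r ?invr_gt0 // ler_nat leqnSn => /(_ isT); apply: le_trans.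
  rewrite -mulrBl -natrB // subSnn mul1r -exprVn.
  have := IH (ltnW kN); rewrite -exprVn -natr1; lra.
pose N := Num.truncn (`|D| / (h 0 - h 1)).
have N0 : (0 : R) < N.+1%:R by rewrite ltr0n.
have := step N N.+1 (leqnn _); rewrite divff ?gt_eqF // => H.
have h0 : 0 < h 0 - h 1 by rewrite subr_gt0.
have : `|D| / (h 0 - h 1) < N.+1%:R by rewrite truncnS_gt.
rewrite ltr_pdivrMr // => D1.
have E : N.+1%:R * (D / N.+1%:R ^+ 2) = D / N.+1%:R.
  by field; rewrite addrC natr1 gt_eqF.
move: H; rewrite E lerBlDr -lerBlDl ler_pdivlMr // => D2.
by have := ler_norm D; rewrite mulrC in D1; lra.
Qed.

(* Subdividing the segment from [A] to [B] makes the quadratic remainder of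
   [trace_taylor] negligible. *)
Lemma trace_monotone n (f g : R -> R) (C : R) (A B : 'M[R]_n) l m :
  (forall x y, `|f y - f x - g x * (y - x)| <= C * (y - x) ^+ 2) ->
  (forall x, 0 <= g x) ->
  A^T = A -> B^T = B -> eigenvalues_of A l -> eigenvalues_of B m ->
  (forall z, inner (z *m A) z <= inner (z *m B) z) ->
  \sum_i f (l i) <= \sum_i f (m i).
Proof.
move=> fg g0 As Bs Al Bm AB.
pose M t := A + t *: (B - A).
have Ms t : (M t)^T = M t by rewrite /M linearD /= linearZ /= linearB /= As Bs.
have [Q /choice[k kE]] := choice (fun t => symmetric_diagonalizes (Ms t)).
pose h t := \sum_i f (k t i).
have -> : \sum_i f (l i) = h 0.
  apply: eigenvalues_sum Al _; have := diagonalizes_eigenvalues (kE 0).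
  by rewrite /M scale0r addr0.
have -> : \sum_i f (m i) = h 1.
  apply: eigenvalues_sum Bm _; have := diagonalizes_eigenvalues (kE 1).
  by rewrite /M scale1r addrC subrK.
apply: (@nondecreasing_of_quadratic_defect h (C * frob (B - A))) => s t st.
have := trace_taylor fg (kE s) (kE t).
have -> : M t - M s = (t - s) *: (B - A).
  by rewrite /M opprD addrACA subrr add0r -scalerBl.
rewrite frobZ -/(h t) -/(h s) ler_norml => /andP[+ _].
have : 0 <= \sum_j g (k s j) * inner (row j (Q s) *m ((t - s) *: (B - A))) (row j (Q s)).
  apply: sumr_ge0 => j _; apply: mulr_ge0 => //.
  rewrite -scalemxAr innerZl mulr_ge0 ?subr_ge0 // mulmxBr innerBl subr_ge0.
  exact: AB.
lra.
Qed.

Lemma eigenvalue_sqr_le_frob n (A Q : 'M[R]_n) l j :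
  diagonalizes Q l A -> l j ^+ 2 <= frob A.
Proof.
move=> [QQ ->]; rewrite frob_trace !trmx_mul trmxK tr_diag_mx !mulmxA.
rewrite -(mulmxA _ Q Q^T) QQ mulmx1 mxtrace_mulC !mulmxA QQ mul1mx.
rewrite mulmx_diag mxtrace_diag (bigD1 j) //= !mxE expr2 lerDl.
by apply: sumr_ge0 => i _; rewrite !mxE -expr2 sqr_ge0.
Qed.

Lemma trace_perturb n (f g : R -> R) (C c t gam bet : R) (A : 'M[R]_n)
    (y : 'rV[R]_n) l m :
  (forall x z, `|f z - f x - g x * (z - x)| <= C * (z - x) ^+ 2) ->
  (forall x, g x <= C) -> (forall x, x ^+ 2 <= frob A -> c <= g x) ->
  0 <= t -> 0 <= gam -> 0 <= bet ->
  let E := gam%:M - bet *: (y^T *m y) in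
  A^T = A -> eigenvalues_of A l -> eigenvalues_of (A + t *: E) m ->
  \sum_i f (m i) <= \sum_i f (l i) + t * (n%:R * C * gam - bet * c * inner y y)
    + C * t ^+ 2 * frob E.
Proof.
move=> fg gC gc t0 gam0 bet0 E As Al.
have Es : E^T = E.
  by rewrite /E linearB /= linearZ /= trmx_mul trmxK tr_scalar_mx.
have Bs : (A + t *: E)^T = A + t *: E by rewrite linearD /= linearZ /= As Es.
move=> Bm; have [Q [l' dA]] := symmetric_diagonalizes As.
have [P [m' dB]] := symmetric_diagonalizes Bs.
rewrite (eigenvalues_sum f Al (diagonalizes_eigenvalues dA)).
rewrite (eigenvalues_sum f Bm (diagonalizes_eigenvalues dB)).
have := trace_taylor fg dA dB.
have -> : A + t *: E - A = t *: E by rewrite addrC addKr.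
rewrite frobZ ler_norml => /andP[_ +].
suff : \sum_j g (l' j) * inner (row j Q *m (t *: E)) (row j Q) <=
    t * (n%:R * C * gam - bet * c * inner y y) by lra.
have -> : t * (n%:R * C * gam - bet * c * inner y y) =
    \sum_j t * (C * gam - bet * c * inner y (row j Q) ^+ 2).
  rewrite -mulr_sumr sumrB -[X in _ = _ * (_ - X)]mulr_sumr (inner_orthonormal_basis y (proj1 dA)).
  by rewrite sumr_const card_ord -[(C * gam) *+ n]mulr_natl mulrA.
apply: ler_sum => j _; rewrite -scalemxAr innerZl mulrCA ler_wpM2l //.
have -> : inner (row j Q *m E) (row j Q) = gam - bet * inner y (row j Q) ^+ 2.
  rewrite /E mulmxBr innerBl mul_mx_scalar innerZl row_orthonormal ?(proj1 dA) // mulr1.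
  rewrite -scalemxAr innerZl mulmxA [_ *m y^T]mx11_scalar mul_scalar_mx innerZl.
  by rewrite -innerE (innerC (row j Q)) expr2.
have := gC (l' j); have := gc _ (eigenvalue_sqr_le_frob j dA).
have : 0 <= bet * inner y (row j Q) ^+ 2 by rewrite mulr_ge0 ?sqr_ge0.
rewrite mulrAC; move: (bet * _) => w w0 gc' gC'; nra.
Qed.

End TraceFunctions.

(** * Calculus of C^2 functions *)

Section Calculus.
Local Open Scope classical_set_scope.
Context {R : realType}.

Lemma is_derive_line (V : normedModType R) (u : V -> R) (x v : V) (t : R) :
  derivable u (x + t *: v) v ->
  is_derive t 1 (fun s => u (x + s *: v)) ('D_v u (x + t *: v)).
Proof.
move=> du; have E : (fun h : R => h^-1 *: (u (x + (h *: 1 + t) *: v) - u (x + t *: v))) =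
    (fun h : R => h^-1 *: (u (h *: v + (x + t *: v)) - u (x + t *: v))).
  by apply/funext => h; rewrite scalerDl [h *: 1]mulr1 addrCA.
by apply: DeriveDef; rewrite /derivable /derive /= E.
Qed.

Lemma MVT_between (f df : R -> R) (a b : R) :
  (forall t : R, is_derive t 1 f (df t)) ->
  exists2 th, 0 < th < 1 & f b - f a = df (a + th * (b - a)) * (b - a).
Proof.
move=> fdf; have fc : continuous f.
  by move=> t; have [/derivable1_diffP/differentiable_continuous] := fdf t.
wlog ab : a b / a < b => [H|].
  have [/H//|ba|->] := ltgtP a b; last by exists (1 / 2); [lra|rewrite !subrr !mulr0].
  have [th th01 E] := H _ _ ba; exists (1 - th); first by lra.
  rewrite -opprB E -mulrN opprB; congr (df _ * _); ring.
have [|c] := @MVT R f df a b ab (fun t _ => fdf t).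
  exact: continuous_subspaceT.
rewrite in_itv /= => /andP[ac cb] E; have ba0 : 0 < b - a by rewrite subr_gt0.
exists ((c - a) / (b - a)); last by rewrite divfK ?gt_eqF // [a + _]addrC subrK.
by rewrite divr_gt0 ?ltr_pdivrMr ?subr_gt0 //= mul1r; lra.
Qed.

Lemma MVT_line (V : normedModType R) (u : V -> R) (x v : V) (h : R) :
  (forall z, derivable u z v) ->
  exists2 th, 0 <= th <= 1 &
    u (x + h *: v) - u x = 'D_v u (x + (th * h) *: v) * h.
Proof.
move=> du.
have [th th01] := MVT_between 0 h (fun t => is_derive_line (du (x + t *: v))).
by rewrite scale0r addr0 subr0 add0r; exists th; rewrite // !ltW; case/andP: th01.
Qed.

Lemma cvg_to_center (V : normedModType R) (z : R -> V) (x : V) (K : R) :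
  (forall h, `|z h - x| <= K * `|h|) -> z h @[h --> (0 : R)^'] --> x.
Proof.
move=> zK; apply/cvgrPdist_le => e e0.
have K0 : 0 < `|K| + 1 by rewrite ltr_wpDl.
have : \forall h \near (0 : R)^', `|h| < e / (`|K| + 1).
  near=> h; near: h; apply: dnbhs0_lt; exact: divr_gt0.
apply: filterS => h; rewrite ltr_pdivlMr // => he.
rewrite distrC; apply: le_trans (zK h) _.
have := ler_norm K; have := normr_ge0 h; nra.
Unshelve. all: by end_near. Qed.

Lemma is_derive_add_direction (V : normedModType R) (u : V -> R) (x v w : V) :
  (forall z, derivable u z v) -> continuous ('D_v u) -> derivable u x w ->
  is_derive x (v + w) u ('D_v u x + 'D_w u x).
Proof.
move=> dv cv dw.
have /choice[th thE] : forall h : R, exists th, 0 <= th <= 1 /\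
    u (x + h *: w + h *: v) - u (x + h *: w) =
      'D_v u (x + h *: w + (th * h) *: v) * h.
  by move=> h; have [th] := MVT_line (x + h *: w) h dv; exists th.
have E : \forall h \near (0 : R)^',
    'D_v u (x + h *: w + (th h * h) *: v) + h^-1 *: (u (h *: w + x) - u x) =
    h^-1 *: ((u \o shift x) (h *: (v + w)) - u x).
  near=> h; have h0 : h != 0 by near: h; exact: nbhs_dnbhs_neq.
  have [_ /(congr1 (fun y => h^-1 * y))] := thE h.
  rewrite [h^-1 * (_ * h)]mulrC mulfK // => <-.
  rewrite /= -![h^-1 *: _]/(h^-1 * _) -mulrDr.
  rewrite (addrC (h *: w)) addrA subrK; congr (_ * (u _ - _)).
  by rewrite scalerDr addrC addrA addrAC.
have L : h^-1 *: ((u \o shift x) (h *: (v + w)) - u x) @[h --> (0 : R)^'] -->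
    ('D_v u x + 'D_w u x).
  apply: cvg_trans (near_eq_cvg E) _; apply: cvgD; last exact: dw.
  have zx : x + h *: w + (th h * h) *: v @[h --> (0 : R)^'] --> x.
    apply: (@cvg_to_center _ _ _ (`|w| + `|v|)) => h.
    rewrite -(addrA x) (addrC x) addrK; apply: le_trans (ler_normD _ _) _.
    rewrite !normrZ ?normrM; have [/andP[t0 t1] _] := thE h.
    have : 0 <= (1 - th h) * (`|h| * `|v|) by rewrite !mulr_ge0 // subr_ge0.
    rewrite (ger0_norm t0); lra.
  exact: cvg_comp zx (cv x).
apply: DeriveDef; first by apply/cvg_ex; eexists; exact: L.
exact: cvg_lim L.
Unshelve. all: by end_near. Qed.

Lemma is_derive_line0 (V : normedModType R) (u : V -> R) (x v : V) (a : R) :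
  is_derive (0 : R) 1 (fun s => u (x + s *: v)) a -> is_derive x v u a.
Proof.
have E : (fun h : R => h^-1 *: (u (x + (h *: 1 + (0 : R)) *: v) - u (x + (0 : R) *: v))) =
    (fun h : R => h^-1 *: (u (h *: v + x) - u x)).
  by apply/funext => h; rewrite addr0 scale0r addr0 [h *: 1]mulr1 [x + _]addrC.
by move=> [d <-]; apply: DeriveDef; move: d; rewrite /derivable /derive /= E.
Qed.

Lemma is_derive_scale_direction (V : normedModType R) (u : V -> R) (x v : V) (c a : R) :
  is_derive x v u a -> is_derive x (c *: v) u (c * a).
Proof.
move=> [du <-]; apply: is_derive_line0.
have -> : (fun s : R => u (x + s *: (c *: v))) =
    (fun s => u (x + s *: v)) \o (fun s => c * s).
  by apply/funext => s; rewrite /= scalerA mulrC.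
have d0 : is_derive (c * 0) 1 (fun s : R => u (x + s *: v)) ('D_v u x).
  have := @is_derive_line _ u x v 0; rewrite scale0r addr0 mulr0; exact.
have d1 : is_derive (0 : R) 1 (fun s : R => c * s) c.
  by apply: is_derive_eq; rewrite /= -[_ *: _]/(_ * _) mulr1.
by rewrite mulrC; exact: is_derive1_comp.
Qed.

Lemma C1_is_derive n (u : 'rV[R]_n -> R) (x v : 'rV[R]_n) : C1 u ->
  is_derive x v u (inner v (gradient u x)).
Proof.
move=> uC.
have pd z i c : is_derive z (c *: evec R i) u (c * partial i u z).
  by apply: is_derive_scale_direction; apply: derivableP; exact: (proj1 (uC i)).
have H (s : seq 'I_n) z : is_derive z (\sum_(i <- s) v 0 i *: evec R i) u
    (\sum_(i <- s) v 0 i * partial i u z).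
  elim: s z => [|i s IH] z.
    rewrite !big_nil; apply: is_derive_line0.
    rewrite (_ : (fun _ => _) = cst (u z)); first exact: is_derive_cst.
    by apply/funext => t; rewrite scaler0 addr0.
  rewrite !big_cons; apply: is_derive_eq.
    apply: is_derive_add_direction; first by move=> y; have [] := pd y i (v 0 i).
      rewrite (_ : 'D__ u = fun y => v 0 i * partial i u y); last first.
        by apply/funext => y; have [_ ->] := pd y i (v 0 i).
      move=> y; apply: continuousM; first exact: cst_continuous.
      exact: (proj2 (uC i)).
    by have [] := IH z.
  by have [_ ->] := pd z i (v 0 i); have [_ ->] := IH z.
have := H (index_enum 'I_n) x; rewrite -[X in is_derive _ X]row_sum_delta.
rewrite /inner; congr (is_derive _ _ _ _).
by apply: eq_bigr => i _; rewrite mxE.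
Qed.

Lemma second_difference (V : normedModType R) (u : V -> R) (x v w : V) (h : R) :
  (forall z, derivable u z v) -> (forall z, derivable ('D_v u) z w) ->
  exists2 z, `|z - x| <= (`|v| + `|w|) * `|h| &
    u (x + h *: v + h *: w) - u (x + h *: v) - u (x + h *: w) + u x =
    'D_w ('D_v u) z * h ^+ 2.
Proof.
move=> dv dw; pose p z := u (z + h *: w) - u z.
have dp z : is_derive z v p ('D_v u (z + h *: w) - 'D_v u z).
  apply: is_deriveB; last exact: derivableP.
  apply: is_derive_line0.
  have := is_derive_line (x := z + h *: w) (t := 0) (dv _).
  rewrite scale0r addr0; congr (is_derive _ _ _ _).
  by apply/funext => s; rewrite addrAC.
have [th /andP[t0 t1] E1] : exists2 th, 0 <= th <= 1 &
    p (x + h *: v) - p x = 'D_v p (x + (th * h) *: v) * h.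
  by apply: MVT_line => z; have [] := dp z.
have [th' /andP[t0' t1'] E2] := MVT_line (x + (th * h) *: v) h dw.
exists (x + (th * h) *: v + (th' * h) *: w).
  rewrite -(addrA x) (addrC x) addrK; apply: le_trans (ler_normD _ _) _.
  rewrite !normrZ ?normrM (ger0_norm t0) (ger0_norm t0').
  have : 0 <= (1 - th) * (`|h| * `|v|) by rewrite !mulr_ge0 // subr_ge0.
  have : 0 <= (1 - th') * (`|h| * `|w|) by rewrite !mulr_ge0 // subr_ge0.
  lra.
transitivity (p (x + h *: v) - p x); first by rewrite /p; ring.
by rewrite E1; have [_ ->] := dp (x + (th * h) *: v); rewrite E2; ring.
Qed.

Lemma mixed_derivatives_commute (V : normedModType R) (u : V -> R) (x v w : V) :
  (forall z, derivable u z v) -> (forall z, derivable u z w) ->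
  (forall z, derivable ('D_v u) z w) -> (forall z, derivable ('D_w u) z v) ->
  continuous ('D_w ('D_v u)) -> continuous ('D_v ('D_w u)) ->
  'D_w ('D_v u) x = 'D_v ('D_w u) x.
Proof.
move=> dv dw dvw dwv cvw cwv.
have /choice[z1 z1E] : forall h, exists z, `|z - x| <= (`|v| + `|w|) * `|h| /\
    u (x + h *: v + h *: w) - u (x + h *: v) - u (x + h *: w) + u x =
    'D_w ('D_v u) z * h ^+ 2.
  by move=> h; have [z] := second_difference x h dv dvw; exists z.
have /choice[z2 z2E] : forall h, exists z, `|z - x| <= (`|w| + `|v|) * `|h| /\
    u (x + h *: w + h *: v) - u (x + h *: w) - u (x + h *: v) + u x =
    'D_v ('D_w u) z * h ^+ 2.
  by move=> h; have [z] := second_difference x h dw dwv; exists z.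
have c1 : 'D_w ('D_v u) (z1 h) @[h --> (0 : R)^'] --> 'D_w ('D_v u) x.
  exact: cvg_comp (cvg_to_center (fun h => proj1 (z1E h))) (cvw x).
have c2 : 'D_v ('D_w u) (z2 h) @[h --> (0 : R)^'] --> 'D_v ('D_w u) x.
  exact: cvg_comp (cvg_to_center (fun h => proj1 (z2E h))) (cwv x).
have E : \forall h \near (0 : R)^', 'D_v ('D_w u) (z2 h) = 'D_w ('D_v u) (z1 h).
  near=> h; have h0 : h != 0 by near: h; exact: nbhs_dnbhs_neq.
  have [_ E1] := z1E h; have [_ E2] := z2E h.
  apply: (mulIf (expf_neq0 2 h0)); rewrite -E1 -E2 (addrAC x); ring.
apply: (cvg_unique _ c1 (cvg_trans (near_eq_cvg E) c2)).
Unshelve. all: by end_near. Qed.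

Section C2functions.
Context (n : nat) (u : 'rV[R]_n -> R) (uC : C2 u).

Lemma C2_is_derive x v : is_derive x v u (inner v (gradient u x)).
Proof. by apply: C1_is_derive; have [] := uC. Qed.

Lemma C2_is_derive2 x v w :
  is_derive x w (fun z => inner v (gradient u z)) (inner (w *m hessian u x) v).
Proof.
have -> : (fun z => inner v (gradient u z)) = \sum_j (fun z => v 0 j * partial j u z).
  by apply/funext => z; rewrite fct_sumE; apply: eq_bigr => j _; rewrite mxE.
apply: is_derive_eq.
  apply: is_derive_sum => j; have [_ _ /(_ j) uj] := uC.
  have := C1_is_derive x w uj; exact: is_deriveZ.
rewrite /= /inner; apply: eq_bigr => j _.
rewrite mxE -[_ *: _]/(_ * _) mulrC; congr (_ * _).
by apply: eq_bigr => i _; rewrite !mxE.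
Qed.

Lemma hessian_symmetric x : (hessian u x)^T = hessian u x.
Proof.
have [_ u1 u2] := uC; apply/matrixP => i j; rewrite !mxE.
apply: mixed_derivatives_commute.
- exact: (proj1 (u1 i)).
- exact: (proj1 (u1 j)).
- exact: (proj1 (u2 i j)).
- exact: (proj1 (u2 j i)).
- exact: (proj2 (u2 i j)).
- exact: (proj2 (u2 j i)).
Qed.

Lemma continuous_hessian_entry i j : continuous (fun x => hessian u x i j).
Proof.
have [_ _ u2] := uC; rewrite (_ : (fun _ => _) = partial i (partial j u)).
  exact: (proj2 (u2 j i)).
by apply/funext => x; rewrite mxE.
Qed.

Lemma continuous_frob_hessian : continuous (fun x => frob (hessian u x)).
Proof.
apply: continuous_sum => i; apply: continuous_sum => j.
rewrite (_ : (fun x => _) = fun x => hessian u x i j * hessian u x i j) // => x.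
by apply: continuousM; exact: continuous_hessian_entry.
Qed.

Lemma continuous_gradient_coord i : continuous (fun x => gradient u x 0 i).
Proof.
have [_ u1 _] := uC; rewrite (_ : (fun _ => _) = partial i u).
  exact: (proj2 (u1 i)).
by apply/funext => x; rewrite mxE.
Qed.

End C2functions.

End Calculus.

(** * The maximum principle *)

Section TouchingTest.
Local Open Scope classical_set_scope.
Context {R : realType}.

Lemma second_derivative_test (w dw : R -> R) (ddw : R) :
  (forall t : R, is_derive t 1 w (dw t)) -> is_derive (0 : R) 1 dw ddw ->
  (forall t, w t <= w 0) -> dw 0 = 0 /\ ddw <= 0.
Proof.
move=> wd dwd wmax.
have dw0 : dw 0 = 0.
  have w0 : is_derive (0 : R) 1 w 0.
    apply: (@derive1_at_max _ w (-1) 1 0) => [|t _||t _]; first by lra.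
    - by have [] := wd t.
    - by rewrite in_itv /=; lra.
    - exact: wmax.
  by have [_ <-] := wd 0; have [_ ->] := w0.
split=> //; rewrite leNgt; apply/negP => dd0.
have [dd ddE] := dwd.
have : \forall h \near (0 : R)^', 0 < h^-1 *: (dw h - dw 0).
  have L : h^-1 *: (dw h - dw 0) @[h --> (0 : R)^'] --> ddw.
    move: dd; rewrite -ddE /derivable /derive /=.
    have -> : (fun h : R => h^-1 *: (dw (h *: (1 : R) + 0) - dw 0)) =
        (fun h => h^-1 *: (dw h - dw 0)).
      by apply/funext => h; rewrite addr0 [h *: 1]mulr1.
    exact.
  exact: (cvgr_gt ddw L).
rewrite /dnbhs /within /= => /nbhs_ballP[e /= e0 he].
have [th /andP[th0 th1] E] := MVT_between 0 (e / 2) wd.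
have e20 : 0 < e / 2 by rewrite divr_gt0.
have := wmax (e / 2); rewrite -subr_le0 E subr0 add0r pmulr_lle0 // leNgt => /negP; apply.
have c0 : 0 < th * (e / 2) by rewrite mulr_gt0.
have /he : ball (0 : R) e (th * (e / 2)).
  rewrite /ball /= sub0r normrN gtr0_norm //; nra.
rewrite gt_eqF // dw0 subr0 => /(_ isT).
by rewrite -[_ *: _]/(_ * _) pmulr_rgt0 // invr_gt0.
Qed.

Lemma is_derive_barrier (al ka s0 p r : R) :
  let s t := s0 + t * (2 * p) + t ^+ 2 * r in
  let ds t := 2 * p + 2 * t * r in
  let e t := expR (- (al * s t)) in
  (forall t : R, is_derive t 1 (fun t => e t - ka * s t)
     (- (al * e t + ka) * ds t)) /\
  is_derive (0 : R) 1 (fun t => - (al * e t + ka) * ds t)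
    (4 * al ^+ 2 * e 0 * p ^+ 2 - 2 * (al * e 0 + ka) * r).
Proof.
move=> s ds e.
have sd (t : R) : is_derive t 1 s (ds t).
  by apply: is_derive_eq; rewrite /ds /GRing.scale /=; ring.
have dsd (t : R) : is_derive t 1 ds (2 * r).
  by apply: is_derive_eq; rewrite /GRing.scale /=; ring.
have ed (t : R) : is_derive t 1 e (e t * (- (al * ds t))).
  have d1 : is_derive t 1 (fun t => - (al * s t)) (- (al * ds t)).
    by apply: is_derive_eq; rewrite /GRing.scale /=; ring.
  exact: (@is_derive1_comp R expR (fun t => - (al * s t)) t _ _ (is_derive_expR _) d1).
split=> [t|]; apply: is_derive_eq; rewrite /GRing.scale /=; first by ring.
rewrite /ds; ring.
Qed.

Lemma le_of_half_quotient_le0 (X Y Z d : R) : 0 < d ->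
  (X - Y) / (2 * d) + Z <= 0 -> X <= Y + 2 * d * - Z.
Proof.
move=> d0 H; have d2 : 0 < 2 * d by rewrite mulr_gt0.
by rewrite -lerBlDl -ler_pdivrMl // mulrC; lra.
Qed.

Lemma touching_test n (u : 'rV[R]_n -> R) (rho d ep al ka : R) (y : 'rV[R]_n) :
  C2 u -> 0 < rho -> 0 < d ->
  let q x := (rho ^- 2 * u (rho *: x) - u x) / (2 * d) in
  let H x := expR (- (al * inner x x)) - ka * inner x x in
  let e := expR (- (al * inner y y)) in
  (forall x, q x + ep * H x <= q y + ep * H y) ->
  (rho^-1 * inner y (gradient u (rho *: y)) - inner y (gradient u y)) / (2 * d) =
    ep * (2 * (al * e + ka) * inner y y) /\
  forall z, inner (z *m hessian u (rho *: y)) z <= inner (z *m hessian u y) z +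
    2 * d * (ep * (2 * (al * e + ka) * inner z z - 4 * al ^+ 2 * e * inner y z ^+ 2)).
Proof.
move=> uC rho0 d0 q H e ymax.
have main z :
  (rho^-1 * inner z (gradient u (rho *: y)) - inner z (gradient u y)) / (2 * d) +
    ep * (- (al * e + ka) * (2 * inner y z)) = 0 /\
  (inner (z *m hessian u (rho *: y)) z - inner (z *m hessian u y) z) / (2 * d) +
    ep * (4 * al ^+ 2 * e * inner y z ^+ 2 - 2 * (al * e + ka) * inner z z) <= 0.
  have [b1 b2] := is_derive_barrier al ka (inner y y) (inner y z) (inner z z).
  pose s t := inner y y + t * (2 * inner y z) + t ^+ 2 * inner z z.
  pose ds t := 2 * inner y z + 2 * t * inner z z.
  have sE t : inner (y + t *: z) (y + t *: z) = s t.
    by rewrite !(innerDl, innerDr, innerZl, innerZr) (innerC z y) /s; ring.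
  pose w t := (rho ^- 2 * u (rho *: y + t *: (rho *: z)) - u (y + t *: z)) / (2 * d)
    + ep * (expR (- (al * s t)) - ka * s t).
  pose dw t := (rho ^- 2 * inner (rho *: z) (gradient u (rho *: y + t *: (rho *: z)))
      - inner z (gradient u (y + t *: z))) / (2 * d)
    + ep * (- (al * expR (- (al * s t)) + ka) * ds t).
  have wE t : w t = q (y + t *: z) + ep * H (y + t *: z).
    by rewrite /w /q /H sE scalerDr !scalerA (mulrC rho).
  have line1 x v (t : R) : is_derive t 1 (fun t : R => u (x + t *: v))
      (inner v (gradient u (x + t *: v))).
    have [du E] := C2_is_derive uC (x + t *: v) v.
    by rewrite -E; exact: is_derive_line.
  have line2 x v : is_derive (0 : R) 1 (fun t : R => inner v (gradient u (x + t *: v)))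
      (inner (v *m hessian u x) v).
    have [du E] := C2_is_derive2 uC x v v.
    rewrite -E -{2}[x]addr0 -(scale0r v).
    by apply: (is_derive_line (u := fun z => inner v (gradient u z))); rewrite scale0r addr0.
  have wd (t : R) : is_derive t 1 w (dw t).
    have l1 := line1 (rho *: y) (rho *: z) t; have l2 := line1 y z t; have b := b1 t.
    apply: is_derive_eq; rewrite /dw /s /ds /GRing.scale /=; ring.
  have dwd : is_derive (0 : R) 1 dw
      ((rho ^- 2 * inner (rho *: z *m hessian u (rho *: y)) (rho *: z) -
        inner (z *m hessian u y) z) / (2 * d) +
       ep * (4 * al ^+ 2 * expR (- (al * s 0)) * inner y z ^+ 2
             - 2 * (al * expR (- (al * s 0)) + ka) * inner z z)).
    have l1 := line2 (rho *: y) (rho *: z); have l2 := line2 y z.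
    apply: is_derive_eq; rewrite /GRing.scale /=; ring.
  have [|E1 E2] := second_derivative_test wd dwd.
    by move=> t; rewrite !wE scale0r addr0.
  have s0 : s 0 = inner y y by rewrite /s; ring.
  have ds0 : ds 0 = 2 * inner y z by rewrite /ds; ring.
  split.
    rewrite -[RHS]E1 /dw s0 ds0 !scale0r !addr0 innerZl -/e; congr (_ / _ + _).
    by congr (_ - _); field; rewrite gt_eqF.
  have Ez : rho ^- 2 * inner (rho *: z *m hessian u (rho *: y)) (rho *: z) =
      inner (z *m hessian u (rho *: y)) z.
    by rewrite -scalemxAl innerZl innerZr; field; rewrite gt_eqF.
  by move: E2; rewrite Ez s0.
split.
  have [/eqP + _] := main y; rewrite addr_eq0 => /eqP ->; ring.
move=> z; have [_ H2] := main z.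
have -> : ep * (2 * (al * e + ka) * inner z z - 4 * al ^+ 2 * e * inner y z ^+ 2) =
    - (ep * (4 * al ^+ 2 * e * inner y z ^+ 2 - 2 * (al * e + ka) * inner z z)) by ring.
exact: le_of_half_quotient_le0 d0 H2.
Qed.


End TouchingTest.

Section Dilations.
Local Open Scope classical_set_scope.
Context {R : realType}.

Definition dilation_speed n (u : 'rV[R]_n -> R) (x : 'rV[R]_n) : R :=
  - u x + 1 / 2 * inner x (gradient u x).
Local Notation phi := dilation_speed.

Lemma norm_sqr_le_inner n (x : 'rV[R]_n) : `|x| ^+ 2 <= inner x x.
Proof.
rewrite -[leRHS]sqr_sqrtr ?inner_ge0 // ler_pXn2r ?nnegrE ?sqrtr_ge0 //.
rewrite [leLHS]/Num.norm /= mx_normrE; apply/bigmax_leP; split.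
  exact: sqrtr_ge0.
move=> -[i j] _ /=; rewrite (ord1 i) -sqrtr_sqr ler_wsqrtr //; exact: coord_sqr_le.
Qed.

Lemma near0_inner n (P : 'rV[R]_n -> Prop) : (\forall x \near (0 : 'rV[R]_n), P x) ->
  exists2 del : R, 0 < del & forall x, inner x x < del -> P x.
Proof.
move=> /nbhs_ballP[e /= e0 eP]; exists (e ^+ 2); first by rewrite exprn_gt0.
move=> x xe; apply: eP; rewrite mx_norm_ball /ball_ /= sub0r normrN.
rewrite -(@ltr_pXn2r _ 2) ?nnegrE ?(ltW e0) //.
exact: le_lt_trans (norm_sqr_le_inner x) xe.
Qed.

Lemma continuous_dilation_speed n (u : 'rV[R]_n -> R) : C2 u -> continuous (phi u).
Proof.
move=> uC x; have [uc _ _] := uC.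
rewrite (_ : phi u = (fun x => - u x) \+ (fun x => 1 / 2 * inner x (gradient u x))) //.
apply: continuousD; first by apply: continuousN; exact: uc.
apply: continuousM; first exact: cst_continuous.
apply: continuous_inner => i; [exact: continuous_coord|].
exact: continuous_gradient_coord.
Qed.

Lemma dilation_quotient n (u : 'rV[R]_n -> R) (d : R) (x : 'rV[R]_n) :
  C2 u -> 0 < d ->
  exists2 th, 0 < th < 1 &
    (expR d ^- 2 * u (expR d *: x) - u x) / (2 * d) =
    expR (- (2 * (th * d))) * phi u (expR (th * d) *: x).
Proof.
move=> uC d0.
pose P (t : R) := expR (- (2 * t)) * u (expR t *: x).
have Pd (t : R) : is_derive t 1 P (2 * (expR (- (2 * t)) * phi u (expR t *: x))).
  have d1 : is_derive t 1 (fun t => expR (- (2 * t))) (expR (- (2 * t)) * (- 2)).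
    apply: (@is_derive1_comp R expR (fun t => - (2 * t))).
    by apply: is_derive_eq; rewrite /GRing.scale /=; ring.
  have d2 : is_derive t 1 (fun t => u (expR t *: x))
      (inner x (gradient u (expR t *: x)) * expR t).
    have d3 : is_derive (expR t) 1 (fun s : R => u (0 + s *: x))
        (inner x (gradient u (expR t *: x))).
      have [du E] := C2_is_derive uC (0 + expR t *: x) x.
      by have := is_derive_line du; rewrite E add0r.
    have -> : (fun t => u (expR t *: x)) = (fun s => u (0 + s *: x)) \o expR.
      by apply/funext => s /=; rewrite add0r.
    exact: is_derive1_comp.
  apply: is_derive_eq; rewrite /GRing.scale /= /dilation_speed innerZl; by field.
have [th th01 E] := MVT_between 0 d Pd; exists th => //.
move: E; rewrite /P mulr0 oppr0 expR0 scale1r mul1r addr0 add0r => E.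
have -> : expR d ^- 2 = expR (- (2 * d)) by rewrite expRN expRM_natl.
by rewrite E; field; rewrite gt_eqF.
Qed.

Lemma uniform_dilation_continuity n (h : 'rV[R]_n -> R) (Y eta : R) :
  continuous h -> 0 < eta ->
  exists2 d0 : R, 0 < d0 & forall t y, 0 <= t -> t < d0 -> inner y y <= Y ->
    `|h (expR t *: y) - h y| <= eta.
Proof.
move=> hc eta0.
pose P (t : R) (y : 'rV[R]_n) := `|h (expR t *: y) - h y| <= eta.
have := (iffLR (compact_near_coveringP _) (@compact_inner_ball R n Y)) R (nbhs (0 : R)) P _.
have cover (x : 'rV[R]_n) : inner x x <= Y -> \forall y \near x & t \near (0 : R), P t y.
  move=> _.
  have c1 : h z.1 @[z --> (x, (0 : R))] --> h x.
    apply: (@cvg_comp _ _ _ fst h _ (nbhs x)); [exact: cvg_fst | exact: hc].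
  have c2 : h (expR z.2 *: z.1) @[z --> (x, (0 : R))] --> h (expR 0 *: x).
    apply: (@cvg_comp _ _ _ (fun z : 'rV[R]_n * R => expR z.2 *: z.1) h _
      (nbhs (expR 0 *: x))); last exact: hc.
    apply: cvgZ; last exact: cvg_fst.
    by apply: (@cvg_comp _ _ _ snd expR _ (nbhs (0 : R))); [exact: cvg_snd|exact: continuous_expR].
  have c : h (expR z.2 *: z.1) - h z.1 @[z --> (x, (0 : R))] --> (0 : R).
    have E0 : h (expR 0 *: x) - h x = 0 by rewrite expR0 scale1r subrr.
    by rewrite -{2}E0; exact: cvgB c2 c1.
  exact: (@cvgr0_norm_le _ _ _ _ _ _ c _ eta0).
move=> /(_ _ cover) => /nbhs_ballP[e /= e0 H]; exists e => // t y t0 te yY.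
apply: (H t) => //=; by rewrite /ball /= sub0r normrN ger0_norm.
Qed.

Lemma expRN_bounds (x : R) : 0 <= x ->
  1 - x <= expR (- x) /\ expR (- x) <= 1 - x + x ^+ 2.
Proof.
move=> x0; split; first by have := expR_ge1Dx (- x).
rewrite expRN; have e1 := expR_ge1Dx x.
have x1 : 0 < 1 + x by lra.
apply: (@le_trans _ _ (1 + x)^-1); first by rewrite lef_pV2 ?posrE ?expR_gt0.
by rewrite -(ler_pM2r x1) mulVf ?gt_eqF //; nra.
Qed.

Lemma frob_bound n (E : 'M[R]_n) (B : R) : (forall i j, `|E i j| <= B) ->
  frob E <= n%:R * (n%:R * B ^+ 2).
Proof.
move=> EB; rewrite /frob.
have -> : n%:R * (n%:R * B ^+ 2) = \sum_(i < n) \sum_(j < n) B ^+ 2.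
  by rewrite !sumr_const !card_ord -[in RHS]mulrnA -[in RHS]mulr_natl natrM mulrA.
apply: ler_sum => i _; apply: ler_sum => j _.
rewrite -real_normK ?num_real // ler_pXn2r ?nnegrE //.
exact: le_trans (normr_ge0 _) (EB i j).
Qed.

Lemma continuous_bounded_on_inner_ball n (h : 'rV[R]_n -> R) (r : R) :
  continuous h -> 0 <= r -> exists M, forall y, inner y y <= r -> h y <= M.
Proof.
move=> hc r0.
have [||c _ cmax] := @EVT_max_rV R n h _ _ (@compact_inner_ball R n r).
- by exists 0 => /=; rewrite inner0l.
- exact: continuous_subspaceT.
- by exists (h c) => y yr; apply: cmax; rewrite inE.
Qed.

End Dilations.

Section MaximumPrinciple.
Local Open Scope classical_set_scope.
Context {R : realType}.
Local Notation phi := dilation_speed.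

(* With [e = exp (- al * s)] and [s = |y|^2], the right-hand side bounds from below
   twice the linearized operator applied to the barrier
   [exp (- al |x|^2) - ka |x|^2] at [y]. Where [s] is large the drift term alone is
   enough, and the ellipticity constant [c'] may be taken to be 0; elsewhere [al] is
   chosen so that the second-order term wins. *)
Lemma barrier_bracket (N C c del al ka s e : R) :
  0 <= N -> 0 <= C -> 0 < c -> 0 < del -> del <= s -> 0 < e ->
  al = (N * C + 1) / (2 * c * del) ->
  ka = 4 * al * expR (- (al * (2 * N * C + 1))) / (4 * N * C + 2) ->
  e = expR (- (al * s)) ->
  exists2 c', (c' = c /\ s <= 2 * N * C + 1) \/ c' = 0 &
  2 * ka <= 2 * (al * e + ka) * s - 2 * N * C * (2 * (al * e + ka)) +
    2 * (4 * al ^+ 2 * e) * c' * s.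
Proof.
move=> N0 C0 c0 del0 dels e0 alE kaE eE.
have NC0 : 0 <= N * C by rewrite mulr_ge0.
have cd0 : 0 < 2 * c * del by rewrite !mulr_gt0.
have al0 : 0 < al by rewrite alE divr_gt0 // ltr_wpDl.
have D0 : 0 < 4 * N * C + 2 by rewrite -mulrA; lra.
set eS := expR _ in kaE; have eS0 : 0 < eS by rewrite expR_gt0.
have ka0 : 0 < ka by rewrite kaE divr_gt0 // !mulr_gt0.
have ae0 : 0 < al * e by rewrite mulr_gt0.
have [sS|sS] := leP s (2 * N * C + 1); last first.
  exists 0; first by right.
  have : 0 <= (al * e + ka) * (s - (2 * N * C + 1)).
    by rewrite mulr_ge0 ?subr_ge0 ?ltW // addr_gt0.
  by lra.
exists c; first by left.
have ee : eS <= e by rewrite eE ler_expR lerN2 ler_pM2l.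
have aE : al * (2 * c * del) = N * C + 1 by rewrite alE divfK ?gt_eqF.
have kE : ka * (4 * N * C + 2) = 4 * al * eS by rewrite kaE divfK ?gt_eqF.
have h1 : 0 <= (al * e + ka) * s.
  by rewrite mulr_ge0 ?ltW // ?addr_gt0 // (lt_le_trans del0).
have h2 : al * e * (al * (2 * c * del)) <= al * e * (al * (2 * c * s)).
  by rewrite !ler_pM2l // mulr_gt0.
have h3 : al * eS <= al * e by rewrite ler_pM2l.
rewrite aE in h2.
have -> : 2 * (4 * al ^+ 2 * e) * c * s = 4 * (al * e * (al * (2 * c * s))) by ring.
lra.
Qed.

Lemma inner_barrier_form n (y z : 'rV[R]_n) (ga be : R) :
  inner (z *m (ga%:M - be *: (y^T *m y))) z = ga * inner z z - be * inner y z ^+ 2.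
Proof.
rewrite mulmxBr innerBl mul_mx_scalar innerZl -scalemxAr innerZl mulmxA.
by rewrite [_ *m y^T]mx11_scalar mul_scalar_mx innerZl -innerE (innerC z y) expr2.
Qed.

Lemma frob_barrier_form n (y : 'rV[R]_n) (ga be G B Y : R) :
  0 <= ga -> ga <= G -> 0 <= be -> be <= B -> inner y y <= Y ->
  frob (ga%:M - be *: (y^T *m y)) <= n%:R * (n%:R * (G + B * Y) ^+ 2).
Proof.
move=> ga0 gaG be0 beB yY; apply: frob_bound => i j.
rewrite !mxE big_ord1 !mxE; apply: le_trans (ler_normB _ _) _; apply: lerD.
  case: (i == j); rewrite ?mulr1n ?mulr0n ?normr0 ?ger0_norm //; exact: le_trans ga0 gaG.
rewrite normrM ger0_norm //.
have Y0 := inner_ge0 y.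
apply: ler_pM => //; apply: le_trans _ yY.
have := coord_sqr_le y i; have := coord_sqr_le y j.
rewrite normrM -(real_normK (num_real (y 0 i))) -(real_normK (num_real (y 0 j))).
have := sqr_ge0 (`|y 0 i| - `|y 0 j|); nra.
Qed.

Lemma speed_identity n (u : 'rV[R]_n -> R) (rho d G : R) (y : 'rV[R]_n) :
  0 < rho -> 0 < d ->
  (rho^-1 * inner y (gradient u (rho *: y)) - inner y (gradient u y)) / (2 * d) = G ->
  phi u (rho *: y) - phi u y =
    d * (G - 2 * ((rho ^- 2 * u (rho *: y) - u y) / (2 * d))) +
    (1 - rho ^- 2) * phi u (rho *: y).
Proof.
move=> r0 d0 <-; rewrite /dilation_speed innerZl; field.
by rewrite !gt_eqF.
Qed.

Lemma dilation_remainder_bound (d w p1 p q K eta : R) : 0 < d ->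
  2 * d - 4 * d ^+ 2 <= w -> w <= 2 * d -> `|p1| <= K -> `|p1 - p| <= eta ->
  `|q - p| <= eta + 2 * d * K ->
  2 * d * q - w * p1 <= 4 * d * eta + 8 * d ^+ 2 * K.
Proof.
move=> d0 w1 w2 p1K p1p qp.
have h1 : (2 * d - w) * p1 <= 4 * d ^+ 2 * K.
  apply: le_trans (ler_norm _) _; rewrite normrM ger0_norm ?subr_ge0 //.
  by apply: ler_pM => //; [rewrite subr_ge0|lra].
have h2 : q - p1 <= 2 * eta + 2 * d * K.
  have := ler_norm (q - p); have := ler_norm (- (p1 - p)); rewrite normrN; lra.
have h3 : 2 * d * (q - p1) <= 2 * d * (2 * eta + 2 * d * K).
  by rewrite ler_pM2l // mulr_gt0.
lra.
Qed.

Lemma continuous_dilation_quotient n (u : 'rV[R]_n -> R) (k c rho : R) :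
  continuous u ->
  continuous (fun x : 'rV[R]_n => (k * u (rho *: x) - u x) / c).
Proof.
move=> uc; apply: continuous_mul; last exact: cst_continuous.
apply: continuous_add; last exact: continuous_opp.
apply: continuous_mul; first exact: cst_continuous.
by apply: continuous_comp_all uc; exact: scaler_continuous.
Qed.

Lemma continuous_barrier n (al ka : R) :
  continuous (fun x : 'rV[R]_n => expR (- (al * inner x x)) - ka * inner x x).
Proof.
have ic k : continuous (fun x : 'rV[R]_n => k * inner x x).
  apply: continuous_mul; first exact: cst_continuous.
  by apply: continuous_inner => i; exact: continuous_coord.
apply: continuous_add; last exact/continuous_opp.
by apply: continuous_comp_all (@continuous_expR R); exact/continuous_opp.
Qed.

Lemma small_step (d0 eta m K D : R) :
  0 < d0 -> 0 < eta -> 0 < m -> 0 <= K -> 0 <= D ->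
  exists d, [/\ 0 < d, d < d0, d * K <= eta & d * D <= m].
Proof.
move=> d00 eta0 m0 K0 D0.
have K1 : 0 < K + 1 by lra.
have D1 : 0 < D + 1 by lra.
exists (Num.min (d0 / 2) (Num.min (eta / (K + 1)) (m / (D + 1)))).
set d := Num.min _ _.
have d1 : d <= d0 / 2 by rewrite ge_min lexx.
have d2 : d <= eta / (K + 1) by rewrite !ge_min lexx orbT.
have d3 : d <= m / (D + 1) by rewrite !ge_min lexx !orbT.
have dpos : 0 < d by rewrite !lt_min !divr_gt0.
clearbody d; rewrite ler_pdivlMr // in d2; rewrite ler_pdivlMr // in d3.
split=> //; lra.
Qed.

Lemma speed_le_speed0 n (u : 'rV[R]_n -> R) (f g : R -> R) (C c0 : R)
    (lam : 'rV[R]_n -> 'I_n -> R) :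
  C2 u ->
  (forall x, `|f x| <= C) ->
  (forall x y, `|f y - f x - g x * (y - x)| <= C * (y - x) ^+ 2) ->
  (forall x, 0 <= g x) -> (forall x, g x <= C) ->
  (forall M, exists2 c, 0 < c & forall x, x ^+ 2 <= M -> c <= g x) ->
  (forall x, eigenvalues_of (hessian u x) (lam x)) ->
  (forall x, \sum_i f (lam x i) = phi u x + c0) ->
  forall x, phi u x <= phi u 0.
Proof.
move=> uC fC fg g0 gC gpos lamE eqn x0; rewrite leNgt; apply/negP => gap.
have C0 : 0 <= C by apply: le_trans (fC 0).
have phic := continuous_dilation_speed uC.
pose N : R := n%:R; have N0 : 0 <= N by rewrite ler0n.
have NC0 : 0 <= N * C by rewrite mulr_ge0.
have [K KE] : exists x : R, x = N * C + `|c0| by eexists.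
have K0 : 0 <= K by rewrite KE addr_ge0.
have phiK x : `|phi u x| <= K.
  have -> : phi u x = \sum_i f (lam x i) - c0 by rewrite eqn addrK.
  rewrite KE; apply: le_trans (ler_normB _ _) _; rewrite lerD2r.
  apply: le_trans (ler_norm_sum _ _ _) _.
  apply: le_trans (ler_sum _ (fun i _ => fC (lam x i))) _.
  by rewrite sumr_const card_ord -mulr_natl.
have [eta etaE] : exists x : R, x = (phi u x0 - phi u 0) / 8 by eexists.
have eta0 : 0 < eta by rewrite etaE divr_gt0 // subr_gt0.
have [del del0 delP] : exists2 del : R, 0 < del &
    forall x, inner x x < del -> phi u x < phi u 0 + eta.
  by apply: near0_inner; apply: cvgr_lt (phic 0) _ _; rewrite ltrDl.
have S00 : 0 <= 2 * N * C + 1 by rewrite -mulrA; lra.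
have [M MP] := continuous_bounded_on_inner_ball (continuous_frob_hessian uC) S00.
have [c cpos cP] := gpos M.
have [al alE] : exists x : R, x = (N * C + 1) / (2 * c * del) by eexists.
have [ka kaE] : exists x : R,
    x = 4 * al * expR (- (al * (2 * N * C + 1))) / (4 * N * C + 2) by eexists.
have al0 : 0 < al by rewrite alE divr_gt0 ?ltr_wpDl // !mulr_gt0.
have ka0 : 0 < ka.
  by rewrite kaE; apply: divr_gt0; [apply: mulr_gt0 (expR_gt0 _)|]; lra.
pose s0 := inner x0 x0; have s00 : 0 <= s0 by exact: inner_ge0.
have D0 : 0 < 1 + ka * s0 by rewrite ltr_pwDl // mulr_ge0 // ?ltW.
have [ep epD] : exists x : R, x = 2 * eta / (1 + ka * s0) by eexists.
have ep0 : 0 < ep by rewrite epD divr_gt0 // ?mulr_gt0.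
have epE : ep * (1 + ka * s0) = 2 * eta by rewrite epD divfK ?gt_eqF.
have epka0 : 0 < ep * ka by rewrite mulr_gt0.
have [Y YE] : exists x : R, x = 2 * K / (ep * ka) + s0 by eexists.
have Y0 : 0 <= Y by rewrite YE addr_ge0 // divr_ge0 ?mulr_ge0 // ?ltW.
pose G := ep * (2 * (al + ka)); pose Bt := ep * (4 * al ^+ 2).
have [NE NEE] : exists x : R, x = N * (N * (G + Bt * Y) ^+ 2) by eexists.
have NE0 : 0 <= NE by rewrite NEE mulr_ge0 // mulr_ge0 // sqr_ge0.
pose eta' := Num.min eta (ka * ep / 8).
have eta'0 : 0 < eta' by rewrite lt_min eta0 divr_gt0 ?mulr_gt0.
have eta'1 : eta' <= eta by rewrite ge_min lexx.
have eta'2 : eta' <= ka * ep / 8 by rewrite ge_min lexx orbT.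
have [d0 d00 d0P] := uniform_dilation_continuity Y phic eta'0.
pose D := 8 * K + 4 * C * NE.
have D00 : 0 <= D by rewrite addr_ge0 // !mulr_ge0.
have [d [dpos dd0 dK dD]] : exists d, [/\ 0 < d, d < d0, d * K <= eta / 2 & d * D <= ka * ep].
  by apply: small_step => //; [exact: divr_gt0|exact: mulr_gt0].
pose rho := expR d; have rho0 : 0 < rho by exact: expR_gt0.
pose q (x : 'rV[R]_n) := (rho ^- 2 * u (rho *: x) - u x) / (2 * d).
have qE x : exists2 th, 0 < th < 1 &
    q x = expR (- (2 * (th * d))) * phi u (expR (th * d) *: x).
  exact: dilation_quotient.
have qK x : `|q x| <= K.
  have [th /andP[th0 _] ->] := qE x; rewrite normrM ger0_norm ?expR_ge0 //.
  rewrite -[leRHS]mul1r; apply: ler_pM; rewrite ?expR_ge0 //.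
  by rewrite -expR0 ler_expR oppr_le0 !mulr_ge0 // ?ltW.
have qphi y : inner y y <= Y -> `|q y - phi u y| <= eta' + 2 * d * K.
  move=> yY; have [th /andP[th0 th1] ->] := qE y.
  set t := th * d; have t0 : 0 <= t by rewrite mulr_ge0 // ?ltW.
  have td : t <= d by rewrite /t ler_piMl // ?ltW.
  have := d0P t y t0 (le_lt_trans td dd0) yY.
  set p := phi u (_ *: y) => h1.
  have [h2 _] : 1 - 2 * t <= expR (- (2 * t)) /\ expR (- (2 * t)) <= 1 - 2 * t + (2 * t) ^+ 2.
    by apply: expRN_bounds; rewrite mulr_ge0.
  have h3 : expR (- (2 * t)) <= 1.
    by rewrite -expR0 ler_expR oppr_le0 mulr_ge0.
  have -> : expR (- (2 * t)) * p - phi u y = (p - phi u y) - (1 - expR (- (2 * t))) * p by ring.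
  apply: le_trans (ler_normB _ _) _; apply: lerD => //.
  have tp : 2 * t <= 2 * d by rewrite ler_pM2l.
  rewrite normrM ger0_norm ?subr_ge0 //; apply: ler_pM; rewrite ?subr_ge0 //.
    by clear -h2 tp; lra.
  exact: phiK.
pose H (x : 'rV[R]_n) := expR (- (al * inner x x)) - ka * inner x x.
have Qc : continuous (fun x : 'rV[R]_n => q x + ep * H x).
  have [uc _ _] := uC; apply: continuous_add; first exact: continuous_dilation_quotient.
  by apply: continuous_mul; [exact: cst_continuous|exact: continuous_barrier].
have [||y] := @EVT_max_rV R n (fun x => q x + ep * H x) _ _ (@compact_inner_ball R n Y).
- by exists 0 => /=; rewrite inner0l.
- exact: continuous_subspaceT Qc.
rewrite inE /= => yY ymaxY.
have {ymaxY}ymax x : q x + ep * H x <= q y + ep * H y.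
  have [xY|xY] := leP (inner x x) Y; first by apply: ymaxY; rewrite inE.
  apply: (@le_trans _ _ (q 0 + ep * H 0)); last first.
    by apply: ymaxY; rewrite inE /= inner0l.
  rewrite /H inner0l !mulr0 oppr0 expR0 addr0 mulr1.
  have := qK x; have := qK 0; rewrite !ler_norml => /andP[h1 _] /andP[_ h2].
  have h3 : expR (- (al * inner x x)) <= 1.
    by rewrite -expR0 ler_expR oppr_le0 mulr_ge0 ?inner_ge0 // ?ltW.
  have h4 : ep * expR (- (al * inner x x)) <= ep by rewrite -[leRHS]mulr1 ler_pM2l.
  have h5 : 2 * K <= ep * ka * inner x x.
    have : 2 * K / (ep * ka) <= inner x x by apply: le_trans (ltW xY); rewrite YE lerDl.
    by rewrite ler_pdivrMr // [inner x x * _]mulrC.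
  by clear -h1 h2 h4 h5 epka0 ep0; lra.
have x0Y : inner x0 x0 <= Y by rewrite YE lerDr divr_ge0 ?mulr_ge0 // ?ltW.
set s := inner y y in yY.
have dels : del <= s.
  rewrite leNgt; apply/negP => /delP phiy.
  have := ymax x0; have := qphi y yY; have := qphi x0 x0Y.
  rewrite !ler_norml => /andP[h1 _] /andP[_ h2].
  have h3 : expR (- (al * s)) <= 1.
    by rewrite -expR0 ler_expR oppr_le0 mulr_ge0 ?inner_ge0 // ?ltW.
  have h4 : ep * H y <= ep.
    rewrite -[leRHS]mulr1 ler_pM2l // /H lerBlDr; apply: le_trans h3 _.
    by rewrite lerDl mulr_ge0 ?inner_ge0 // ?ltW.
  have h5 : - (ep * (ka * s0)) <= ep * H x0.
    by rewrite -mulrN ler_pM2l // /H lerDr expR_ge0.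
  have h6 : phi u x0 = phi u 0 + 8 * eta by rewrite etaE; field.
  by clear -h1 h2 h4 h5 h6 eta'1 dK epE eta0 phiy; lra.
pose e := expR (- (al * s)); have e0 : 0 < e by exact: expR_gt0.
have e1 : e <= 1.
  by rewrite -expR0 ler_expR oppr_le0 mulr_ge0 ?inner_ge0 // ?ltW.
have ae0 : 0 < al * e by rewrite mulr_gt0.
have [c' c'P bracket] := barrier_bracket N0 C0 cpos del0 dels e0 alE kaE erefl.
have [T1 T2] := touching_test uC rho0 dpos ymax.
rewrite -/s -/e in T1 T2.
pose ga := ep * (2 * (al * e + ka)); pose be := ep * (4 * al ^+ 2 * e).
have ga0 : 0 <= ga by rewrite !mulr_ge0 // ?ltW // ?addr_gt0.
have be0 : 0 <= be by rewrite !mulr_ge0 // ?ltW // ?exprn_gt0.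
pose A := hessian u y; pose E := ga%:M - be *: (y^T *m y).
have As : A^T = A by exact: hessian_symmetric.
have Es : E^T = E.
  by rewrite /E linearB /= linearZ /= trmx_mul trmxK tr_scalar_mx.
have Bs : (A + (2 * d) *: E)^T = A + (2 * d) *: E by rewrite linearD /= linearZ /= As Es.
have [Q [lm /diagonalizes_eigenvalues lmE]] := symmetric_diagonalizes Bs.
have S1 : \sum_i f (lam (rho *: y) i) <= \sum_i f (lm i).
  apply: (trace_monotone fg g0 (hessian_symmetric uC _) Bs (lamE _) lmE) => z.
  rewrite mulmxDr innerDl -scalemxAr innerZl inner_barrier_form.
  apply: le_trans (T2 z) _; rewrite lerD2l le_eqVlt; apply/orP; left; apply/eqP.
  by rewrite /ga /be; ring.
have gc' x : x ^+ 2 <= frob A -> c' <= g x.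
  case: c'P => [[-> sS]|->] // xA; apply: cP; apply: le_trans xA _; exact: MP.
have d2 : 0 <= 2 * d by rewrite mulr_ge0 // ?ltW.
have := trace_perturb fg gC gc' d2 ga0 be0 As (lamE y) lmE.
rewrite -/s -/E => S2.
have FE : frob E <= NE.
  rewrite NEE; apply: frob_barrier_form => //.
    rewrite /ga /G ler_pM2l // ler_pM2l // lerD2r.
    by rewrite -[leRHS]mulr1 ler_pM2l.
  rewrite /be /Bt ler_pM2l // -[leRHS]mulr1 ler_pM2l //.
  by rewrite mulr_gt0 // ?exprn_gt0.
have := speed_identity rho0 dpos T1; rewrite -/(q y) => ident.
have [w1 w2] : 1 - 2 * d <= expR (- (2 * d)) /\ expR (- (2 * d)) <= 1 - 2 * d + (2 * d) ^+ 2.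
  exact: expRN_bounds.
have rE : rho ^- 2 = expR (- (2 * d)) by rewrite expRN expRM_natl.
have P : 2 * d * q y - (1 - rho ^- 2) * phi u (rho *: y) <= 4 * d * eta' + 8 * d ^+ 2 * K.
  apply: (@dilation_remainder_bound _ _ _ (phi u y)) => //.
  - by rewrite rE; clear -w1 w2; lra.
  - by rewrite rE; clear -w1 w2; lra.
  - by apply: d0P => //; exact: ltW.
  - exact: qphi.
have dF : C * (2 * d) ^+ 2 * frob E <= C * (2 * d) ^+ 2 * NE.
  by rewrite ler_wpM2l // mulr_ge0 // ?sqr_ge0.
have B2 : ep * (2 * ka) <= ep * (2 * (al * e + ka) * s - 2 * N * C * (2 * (al * e + ka)) +
    2 * (4 * al ^+ 2 * e) * c' * s) by rewrite ler_pM2l.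
have final : d * (ep * (2 * ka)) <= d * (4 * eta' + d * D).
  apply: (@le_trans _ _ (d * (ep * (2 * (al * e + ka) * s - 2 * N * C * (2 * (al * e + ka)) +
    2 * (4 * al ^+ 2 * e) * c' * s)))); first by rewrite ler_pM2l.
  have e1' := eqn (rho *: y); have e2' := eqn y.
  rewrite -/N /ga /be in S2; rewrite /D; clear -S1 S2 e1' e2' ident P dF; lra.
rewrite ler_pM2l // in final; clear -final dD eta'2 epka0; lra.
Qed.

End MaximumPrinciple.

(** * Branches of the arctangent *)

Section Arctangent.
Local Open Scope classical_set_scope.
Context {R : realType}.

Lemma cot_lt1 (tau : R) : pi / 4 < tau -> tau < pi / 2 -> 0 < cot tau < 1.
Proof.
move=> t1 t2; have pi0 := pi_gt0 R.
have c0 : 0 < cos tau by apply: cos_gt0_pihalf; lra.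
have s0 : 0 < sin tau by apply: sin_gt0_pihalf; lra.
have : tan (pi / 4) < tan tau.
  by rewrite ltr_tan // in_itv /=; lra.
rewrite tan_piquarter /tan ltr_pdivlMr // mul1r => cs.
by rewrite /cot divr_gt0 // ltr_pdivrMr // mul1r.
Qed.

Lemma atan_cayley (x : R) : x != -1 ->
  atan ((x - 1) / (x + 1)) = atan x - pi / 4 + (x < -1)%R%:R * pi.
Proof.
move=> x1; have pi0 := pi_gt0 R.
have x10 : x + 1 != 0 by rewrite addr_eq0.
have h1 := atan_gtNpi2 x; have h2 := atan_ltpi2 x.
have aN1 : atan (- 1) = - (pi / 4) :> R by rewrite atanN atan1.
have tanE : tan (atan x - pi / 4) = (x - 1) / (x + 1).
  rewrite tanD; last first.
  - by rewrite gt_eqF //; apply: cos_gt0_pihalf; lra.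
  - by rewrite gt_eqF //; apply: cos_gt0_pihalf; lra.
  by rewrite tanN tan_piquarter atanK mulrN1 opprK addrC (addrC 1) [- 1 + x]addrC.
have [xlt|xgt] := ltP x (-1).
  rewrite mul1r -tanE -tanDpi tanK // in_itv /=.
  have := lt_atan xlt; rewrite aN1; lra.
have {}xgt : -1 < x by rewrite lt_neqAle eq_sym x1.
rewrite mul0r addr0 -tanE tanK // in_itv /=.
have := lt_atan xgt; rewrite aN1; lra.
Qed.

Lemma atan_mvt (x y : R) : exists2 z,
  `|z - x| <= `|y - x| & atan y - atan x = (y - x) / (1 + z ^+ 2).
Proof.
have [th /andP[t0 t1] E] := MVT_between x y (fun t => is_derive1_atan t).
exists (x + th * (y - x)); last by rewrite E mulrC.
by rewrite addrC addKr normrM (gtr0_norm t0) ler_piMl // ltW.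
Qed.

Lemma atan_lipschitz (x y : R) : `|atan y - atan x| <= `|y - x|.
Proof.
have [z _ ->] := atan_mvt x y.
have z1 : 1 <= 1 + z ^+ 2 by rewrite lerDl sqr_ge0.
rewrite normrM ler_piMr // ger0_norm ?invr_ge0 ?(le_trans ler01) //.
by rewrite invf_le1 // (lt_le_trans ltr01).
Qed.

Lemma atan_taylor (x y : R) :
  `|atan y - atan x - (y - x) / (1 + x ^+ 2)| <= (y - x) ^+ 2.
Proof.
have [z zx ->] := atan_mvt x y.
have z1 : 1 <= 1 + z ^+ 2 by rewrite lerDl sqr_ge0.
have x1 : 1 <= 1 + x ^+ 2 by rewrite lerDl sqr_ge0.
have z0 : 0 < 1 + z ^+ 2 by apply: lt_le_trans z1.
have x0 : 0 < 1 + x ^+ 2 by apply: lt_le_trans x1.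
have -> : (y - x) / (1 + z ^+ 2) - (y - x) / (1 + x ^+ 2) =
    (y - x) * ((x - z) * ((x + z) / ((1 + x ^+ 2) * (1 + z ^+ 2)))).
  by field; rewrite !gt_eqF.
rewrite -[leRHS](ger0_norm (sqr_ge0 _)) expr2 !normrM.
apply: ler_pM; rewrite ?normr_ge0 ?mulr_ge0 //.
rewrite -[leRHS]mulr1; apply: ler_pM; rewrite ?normr_ge0 ?mulr_ge0 //.
  by rewrite distrC.
rewrite -normrM normrM normfV ler_pdivrMr ?normr_gt0 ?gt_eqF ?mulr_gt0 //.
rewrite mul1r (gtr0_norm (mulr_gt0 x0 z0)) ler_norml.
have := sqr_ge0 (x - 1); have := sqr_ge0 (x + 1).
have := sqr_ge0 (z - 1); have := sqr_ge0 (z + 1); nra.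
Qed.

End Arctangent.

Section Branches.
Local Open Scope classical_set_scope.
Context {R : realType}.

Lemma continuous_nat_valued (h : R -> R) : continuous h ->
  (forall t, exists m : nat, h t = m%:R) -> h 1 = h 0.
Proof.
move=> hc hN.
have noV (m k : nat) : m%:R + 1 / 2 <> k%:R :> R.
  move=> /(congr1 (fun z => z * 2)); rewrite mulrDl divfK ?mul1r // => E.
  have : (m * 2 + 1)%:R = (k * 2)%:R :> R by rewrite natrD !natrM.
  move/eqP; rewrite eqr_nat => /eqP /(congr1 odd).
  by rewrite oddD !oddM !andbF.
have key (a b : R) (p q : nat) : h a = p%:R -> h b = q%:R -> (p < q)%N ->
    Num.min (h a) (h b) <= p%:R + 1 / 2 <= Num.max (h a) (h b).
  move=> -> -> pq; have : (p.+1%:R : R) <= q%:R by rewrite ler_nat.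
  rewrite -natr1 => pq'; rewrite ge_min le_max; apply/andP; split; apply/orP.
    by left; lra.
  by right; lra.
have [p hp] := hN 0; have [q hq] := hN 1.
have hc' : {within `[0, 1], continuous h} by exact: continuous_subspaceT.
have [pq|qp|pq] := ltngtP p q; last by rewrite hq hp pq.
  have [c _ hcE] := IVT ler01 hc' (key _ _ _ _ hp hq pq).
  by have [k kE] := hN c; case: (noV p k); rewrite -kE.
have := key _ _ _ _ hq hp qp; rewrite minC maxC => kk.
have [c _ hcE] := IVT ler01 hc' kk.
by have [k kE] := hN c; case: (noV q k); rewrite -kE.
Qed.

Lemma continuous_trace (T : topologicalType) n (M : T -> 'M[R]_n) (lam : T -> 'I_n -> R)
    (f : R -> R) (C : R) :
  (forall i j, continuous (fun x => M x i j)) -> (forall x, (M x)^T = M x) ->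
  (forall x, eigenvalues_of (M x) (lam x)) ->
  (forall x y, `|f y - f x| <= C * `|y - x|) ->
  continuous (fun x => \sum_i f (lam x i)).
Proof.
move=> Mc Ms lamE fl x; apply/cvgrPdist_le => e e0.
have C0 : 0 <= C by have := fl 0 1; rewrite subr0 normr1 mulr1; apply: le_trans.
pose d := e / 2 / (n%:R * C + 1).
have nC : 0 < n%:R * C + 1 by rewrite ltr_wpDl // mulr_ge0.
have d0 : 0 < d by rewrite !divr_gt0.
have dE : d * (n%:R * C + 1) = e / 2 by rewrite divfK ?gt_eqF.
have C1 : 0 < C + 1 by rewrite ltr_wpDl.
pose r := e / 2 * d / (C + 1); have r0 : 0 < r by rewrite divr_gt0 // mulr_gt0 // divr_gt0.
have rE : r * (C + 1) = e / 2 * d by rewrite divfK ?gt_eqF.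
have fc : continuous (fun y => frob (M y - M x)).
  apply: continuous_sum => i; apply: continuous_sum => j.
  rewrite (_ : (fun y => _) = fun y => (M y i j - M x i j) * (M y i j - M x i j)); last first.
    by apply/funext => y; rewrite !mxE expr2.
  have c : continuous (fun y => M y i j - M x i j).
    by apply: continuous_add => //; exact: cst_continuous.
  exact: continuous_mul.
have : \forall y \near x, frob (M y - M x) < r.
  apply: cvgr_lt (fc x) _ _; rewrite subrr.
  by rewrite /frob big1 // => i _; rewrite big1 // => j _; rewrite mxE expr0n.
apply: filterS => y yr; rewrite distrC.
apply: le_trans (trace_lipschitz (Ms x) (Ms y) (lamE x) (lamE y) fl d0) _.
have F0 := frob_ge0 (M y - M x).
have h1 : C * (frob (M y - M x) / d) <= e / 2.
  by rewrite mulrA ler_pdivrMr //; nra.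
rewrite mulrDr; nra.
Qed.

End Branches.

(** * Conclusion *)

Section Homogeneity.
Local Open Scope classical_set_scope.
Context {R : realType}.
Local Notation phi := dilation_speed.

Lemma continuous_eventually_constant (h : R -> R) (c : R) : continuous h ->
  (forall t, 0 < t -> h t = c) -> h 0 = c.
Proof.
move=> hc hE; have h1 : h t @[t --> 0^'+] --> h 0 by apply: cvg_at_right_filter; exact: hc.
have E : \forall t \near 0^'+, c = h t by near=> t; rewrite hE.
exact: (cvg_unique _ h1 (cvg_trans (near_eq_cvg E) (cvg_cst c))).
Unshelve. all: by end_near. Qed.

Lemma quadratic_of_constant_speed n (u : 'rV[R]_n -> R) : C2 u ->
  (forall x, phi u x = phi u 0) ->
  forall x, u x = u 0 + 1 / 2 * inner x (x *m hessian u 0).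
Proof.
move=> uC phi0 x.
pose m (t : R) := inner x (gradient u (t *: x)).
pose dm (t : R) := inner (x *m hessian u (t *: x)) x.
have md (t : R) : is_derive t 1 m (dm t).
  have [du E] := C2_is_derive2 uC (0 + t *: x) x x.
  rewrite add0r in E.
  have := is_derive_line (u := fun z => inner x (gradient u z)) du.
  rewrite add0r E; congr (is_derive _ _ _ _).
  by apply/funext => s; rewrite add0r.
have ud (t : R) : is_derive t 1 (fun s : R => u (s *: x)) (m t).
  have [du E] := C2_is_derive uC (0 + t *: x) x.
  have := is_derive_line du; rewrite E add0r; congr (is_derive _ _ _ _).
  by apply/funext => s; rewrite add0r.
have uE t : u (t *: x) = u 0 + 1 / 2 * (t * m t).
  have := phi0 (t *: x); rewrite /dilation_speed inner0l mulr0 addr0 innerZl -/(m t); lra.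
have dmE t : t * dm t = m t.
  have d1 := ud t.
  have d2 : is_derive t 1 (fun s : R => u (s *: x)) (1 / 2 * (m t + t * dm t)).
    rewrite (_ : (fun s : R => _) = fun s => u 0 + 1 / 2 * (s * m s)); last first.
      by apply/funext => s.
    have md' := md t.
    by apply: is_derive_eq; rewrite /GRing.scale /=; ring.
  have [_ e1] := d1; have [_ e2] := d2; rewrite e1 in e2; lra.
have mE (t : R) : m (expR t) = expR t * m 1.
  pose r (s : R) := expR (- s) * m (expR s).
  have rd (s : R) : is_derive s 1 r 0.
    have e1 : is_derive s 1 (fun s : R => expR (- s)) (expR (- s) * (- 1)).
      have d1 : is_derive s 1 (fun s : R => - s) (- 1).
        by apply: is_derive_eq.
      exact: (@is_derive1_comp R expR (fun s => - s) s _ _ (is_derive_expR _) d1).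
    have e2 : is_derive s 1 (fun s : R => m (expR s)) (dm (expR s) * expR s).
      exact: (@is_derive1_comp R m expR s _ _ (md _) (is_derive_expR _)).
    apply: is_derive_eq; rewrite /GRing.scale /= -(dmE (expR s)); ring.
  have [th _] := MVT_between 0 t rd; rewrite mul0r => /eqP.
  rewrite subr_eq0 /r oppr0 expR0 mul1r => /eqP <-.
  by rewrite mulrA -expRD subrr expR0 mul1r.
have dmc t : 0 < t -> dm t = m 1.
  move=> t0; have tn0 : t != 0 by rewrite gt_eqF.
  by apply: (mulfI tn0); rewrite dmE -[in LHS](lnK t0) mE lnK.
have dm_cont : continuous dm.
  apply: continuous_inner => i; last exact: cst_continuous.
  rewrite (_ : (fun t => _) = fun t => \sum_j x 0 j * hessian u (t *: x) j i); last first.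
    by apply/funext => t; rewrite mxE.
  apply: continuous_sum => j; apply: continuous_mul; first exact: cst_continuous.
  apply: (@continuous_comp_all _ _ _ (fun t : R => t *: x) (fun z => hessian u z j i)).
    exact: scalel_continuous.
  exact: continuous_hessian_entry.
have E0 := continuous_eventually_constant dm_cont dmc.
have -> : u x = u (1 *: x) by rewrite scale1r.
by rewrite uE (mul1r (m 1)) -E0 /dm scale0r innerC.
Qed.

Lemma constant_speed n (u : 'rV[R]_n -> R) (f g : R -> R) (C c0 : R)
    (lam : 'rV[R]_n -> 'I_n -> R) :
  C2 u ->
  (forall x, `|f x| <= C) ->
  (forall x y, `|f y - f x - g x * (y - x)| <= C * (y - x) ^+ 2) ->
  (forall x, 0 <= g x) -> (forall x, g x <= C) ->
  (forall M, exists2 c, 0 < c & forall x, x ^+ 2 <= M -> c <= g x) ->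
  (forall x, eigenvalues_of (hessian u x) (lam x)) ->
  (forall x, \sum_i f (lam x i) = phi u x + c0) ->
  forall x, phi u x = phi u 0.
Proof.
move=> uC fC fg g0 gC gpos lamE eqn x; apply/eqP; rewrite eq_le.
rewrite (speed_le_speed0 uC fC fg g0 gC gpos lamE eqn) /=.
pose v y := - u y; have [uc u1 u2] := uC.
have pN (w : 'rV[R]_n -> R) i : C1 w -> partial i (fun y => - w y) = fun y => - partial i w y.
  by move=> w1; apply/funext => y; rewrite /partial deriveN //; exact: (proj1 (w1 i)).
have C1N (w : 'rV[R]_n -> R) : C1 w -> C1 (fun y => - w y).
  move=> w1 i; rewrite pN //; split=> [y|]; first exact/derivableN/(proj1 (w1 i)).
  exact/continuous_opp/(proj2 (w1 i)).
have vC : C2 v.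
  split=> [||i]; [exact: continuous_opp|exact: C1N|].
  by rewrite /v pN //; exact: C1N.
have gradN y : gradient v y = - gradient u y.
  by apply/rowP => i; rewrite !mxE /v pN.
have hessN y : hessian v y = - hessian u y.
  by apply/matrixP => i j; rewrite !mxE /v pN // pN.
have speedN y : phi v y = - phi u y.
  by rewrite /dilation_speed gradN innerC innerNl (innerC _ y) /v; ring.
have /choice[mu muE] : forall y, exists m, eigenvalues_of (hessian v y) m /\
    \sum_i (- f (- m i)) = - \sum_i f (lam y i).
  move=> y; have [Q [l dl]] := symmetric_diagonalizes (hessian_symmetric uC y).
  exists (fun i => - l i); split.
    apply: (@diagonalizes_eigenvalues _ _ Q); case: dl => QQ hE; split=> //.
    rewrite hessN hE -mulNmx -mulmxN; congr (_ *m _ *m _); apply/matrixP => i j.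
    by rewrite !mxE mulNrn.
  rewrite (eigenvalues_sum f (lamE y) (diagonalizes_eigenvalues dl)) -sumrN.
  by apply: eq_bigr => i _; rewrite opprK.
rewrite -lerN2 -!speedN.
apply: (@speed_le_speed0 R n v (fun z => - f (- z)) (fun z => g (- z)) C (- c0) mu) => //.
- by move=> z; rewrite normrN.
- move=> y z; have := fg (- y) (- z).
  rewrite -normrN (_ : (- z - - y) ^+ 2 = (z - y) ^+ 2); last by ring.
  by rewrite (_ : - (_ - _ - _) = - f (- z) - - f (- y) - g (- y) * (z - y)) //; ring.
- move=> M; have [c c_gt cP] := gpos M; exists c => // z zM.
  by apply: cP; rewrite sqrrN.
- by move=> y; have [] := muE y.
- by move=> y; have [_ ->] := muE y; rewrite eqn speedN opprD.
Qed.

Lemma quadratic_polynomial_form n (u : 'rV[R]_n -> R) (c : R) (A : 'M[R]_n) :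
  (forall x, u x = c + 1 / 2 * inner x (x *m A)) -> quadratic_polynomial u.
Proof.
move=> uE.
pose t (i j : 'I_n) : mpoly n R :=
  (1 / 2 * A j i) *: mpolyX R (mnm_add (mnm1 i) (mnm1 j)).
exists (mpolyC n c + \sum_i \sum_j t i j).
  apply: leq_trans (mmeasureD_le _ _ _) _; rewrite geq_max mmeasureC.
  apply/andP; split; first by case: (c != 0).
  apply: leq_trans (mmeasure_sum _ _ _ _) _; apply/bigmax_leqP => i _.
  apply: leq_trans (mmeasure_sum _ _ _ _) _; apply/bigmax_leqP => j _.
  apply: leq_trans (mmeasureZ_le _ _ _) _.
  by rewrite mmeasureX /= mdegD !mdeg1.
move=> x; rewrite uE mevalD mevalC raddf_sum /inner mulr_sumr; congr (_ + _).
apply: eq_bigr => i _; rewrite raddf_sum mxE /= mulr_sumr mulr_sumr.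
apply: eq_bigr => j _; rewrite /t mevalZ mpolyXD mevalM !mevalXU; ring.
Qed.

End Homogeneity.

Section Phase.
Local Open Scope classical_set_scope.
Context {R : realType}.
Local Notation phi := dilation_speed.

Lemma scaled_atan_bounds (k a b : R) : 0 < k -> 0 < b ->
  let f l := k * atan ((l + a) / b) in
  let g l := k / b / (1 + ((l + a) / b) ^+ 2) in
  exists C,
    [/\ forall x, `|f x| <= C,
        forall x y, `|f y - f x - g x * (y - x)| <= C * (y - x) ^+ 2,
        forall x y, `|f y - f x| <= C * `|y - x|,
        forall x, 0 <= g x <= C &
        forall M, exists2 c, 0 < c & forall x, x ^+ 2 <= M -> c <= g x].
Proof.
move=> k0 b0 f g; have kb0 : 0 < k / b by exact: divr_gt0.
have kbb0 : 0 < k / b ^+ 2 by rewrite divr_gt0 // exprn_gt0.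
have kpi0 : 0 < k * (pi / 2) by rewrite mulr_gt0 // divr_gt0 // pi_gt0.
pose C := k / b ^+ 2 + k / b + k * (pi / 2).
have D1 x : 1 <= 1 + ((x + a) / b) ^+ 2 by rewrite lerDl sqr_ge0.
have D0 x : 0 < 1 + ((x + a) / b) ^+ 2 by apply: lt_le_trans (D1 x).
have dE x y : (y + a) / b - (x + a) / b = (y - x) / b by field; rewrite gt_eqF.
exists C; split=> [x|x y|x y|x|M].
- rewrite /f normrM (gtr0_norm k0); apply: (@le_trans _ _ (k * (pi / 2))).
    rewrite ler_pM2l // ler_norml (ltW (atan_ltpi2 _)) andbT.
    by rewrite ltW // atan_gtNpi2.
  by rewrite /C; lra.
- have -> : f y - f x - g x * (y - x) = k * (atan ((y + a) / b) - atan ((x + a) / b) -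
      ((y + a) / b - (x + a) / b) / (1 + ((x + a) / b) ^+ 2)).
    by rewrite dE /f /g; ring.
  rewrite normrM (gtr0_norm k0).
  apply: (@le_trans _ _ (k / b ^+ 2 * (y - x) ^+ 2)).
    have := atan_taylor ((x + a) / b) ((y + a) / b).
    rewrite -(ler_pM2l k0) => /le_trans; apply; rewrite dE le_eqVlt; apply/orP; left.
    by apply/eqP; field; rewrite gt_eqF.
  by rewrite ler_wpM2r ?sqr_ge0 // /C; lra.
- rewrite /f -mulrBr normrM (gtr0_norm k0).
  apply: (@le_trans _ _ (k / b * `|y - x|)).
    have := atan_lipschitz ((x + a) / b) ((y + a) / b).
    rewrite -(ler_pM2l k0) => /le_trans; apply; rewrite dE normrM normfV (gtr0_norm b0).
    by rewrite le_eqVlt; apply/orP; left; apply/eqP; field; rewrite gt_eqF.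
  by rewrite ler_wpM2r // /C; lra.
- rewrite /g divr_ge0 ?(ltW kb0) ?(ltW (D0 x)) //=.
  apply: (@le_trans _ _ (k / b)); last by rewrite /C; lra.
  by rewrite ler_pdivrMr // ler_peMr // ltW.
- pose W := (2 * `|M| + 2 * a ^+ 2) / b ^+ 2.
  have W0 : 0 <= W.
    apply: divr_ge0; last exact: sqr_ge0.
    by have := sqr_ge0 a; have := normr_ge0 M; lra.
  have W1 : 0 < 1 + W by rewrite ltr_wpDr.
  exists (k / b / (1 + W)) => [|x xM]; first by rewrite divr_gt0.
  rewrite /g ler_pM2l // lef_pV2 ?posrE // lerD2l expr_div_n /W.
  rewrite ler_pM2r ?invr_gt0 ?exprn_gt0 //.
  by have := ler_norm M; have := sqr_ge0 (x - a); lra.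
Qed.

(* An eigenvalue below the pole [- (a + b)] shifts its arctangent by [pi]. *)
Definition pole_side (a b l : R) : nat := ((l + a) / b < -1)%R.

Lemma phaseE n (a b : R) (l : 'I_n -> R) : 0 < b -> (forall i, l i <> - (a + b)) ->
  let k := Num.sqrt (a ^+ 2 + 1) / b in
  phase a b l = \sum_i k * atan ((l i + a) / b) +
    k * (pi * (\sum_i pole_side a b (l i))%:R - n%:R * (pi / 4)).
Proof.
move=> b0 lP k; rewrite /phase -/k -mulr_sumr -mulrDr; congr (_ * _).
have -> : n%:R * (pi / 4) = \sum_(i < n) (pi / 4 : R).
  by rewrite sumr_const card_ord mulr_natl.
rewrite natr_sum mulr_sumr -sumrB -big_split; apply: eq_bigr => i _ /=.
have x1 : (l i + a) / b != -1.
  apply/eqP => E; apply: (lP i); have : (l i + a) / b * b = - b by rewrite E mulN1r.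
  by rewrite divfK ?gt_eqF // => E'; lra.
have -> : (l i + a - b) / (l i + a + b) = ((l i + a) / b - 1) / ((l i + a) / b + 1).
  field; rewrite gt_eqF //=; apply/eqP => E; apply: (lP i); lra.
by rewrite atan_cayley // /pole_side; ring.
Qed.

Lemma pole_count_constant n (u : 'rV[R]_n -> R) (a b : R) (lam : 'rV[R]_n -> 'I_n -> R) :
  0 < b -> C2 u -> (forall x, eigenvalues_of (hessian u x) (lam x)) ->
  (forall x i, lam x i <> - (a + b)) ->
  (forall x, phase a b (lam x) = phi u x) ->
  forall x, (\sum_i pole_side a b (lam x i) = \sum_i pole_side a b (lam 0%R i))%N.
Proof.
move=> b0 uC lamE lamP u_eq x.
pose k := Num.sqrt (a ^+ 2 + 1) / b.
have k0 : 0 < k by rewrite divr_gt0 // sqrtr_gt0 ltr_wpDl ?sqr_ge0.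
have [C [_ _ fl _ _]] := scaled_atan_bounds a k0 b0.
pose F y := \sum_i k * atan ((lam y i + a) / b).
have Fc : continuous F.
  exact: continuous_trace (continuous_hessian_entry uC) (hessian_symmetric uC) lamE fl.
pose W y := (k * pi)^-1 * (phi u y - F y + k * (n%:R * (pi / 4))).
have kpi0 : 0 < k * pi by rewrite mulr_gt0 // pi_gt0.
have WE y : W y = (\sum_i pole_side a b (lam y i))%:R.
  rewrite /W -u_eq phaseE // -/k /F; apply: (mulfI (lt0r_neq0 kpi0)).
  by rewrite mulVKf ?gt_eqF //; ring.
have Wc : continuous W.
  apply: continuous_mul; first exact: cst_continuous.
  apply: continuous_add; last exact: cst_continuous.
  apply: continuous_add; first exact: continuous_dilation_speed.
  exact: continuous_opp.
pose h (t : R) := W (t *: x).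
have hc : continuous h.
  apply: (@continuous_comp_all _ _ _ (fun t : R => t *: x) W) => //.
  exact: scalel_continuous.
have /eqP := continuous_nat_valued hc (fun t => ex_intro _ _ (WE (t *: x))).
by rewrite /h !WE scale1r scale0r eqr_nat => /eqP.
Qed.

End Phase.

Unset Implicit Arguments.
Theorem theorem1p3 (R : realType) (n : nat) (n_ge1 : (1 <= n)%N)
    (tau : R) (tau_gt : pi / 4 < tau) (tau_lt : tau < pi / 2)
    (a b : R) (aE : a = cot tau) (bE : b = Num.sqrt (1 - cot tau ^+ 2))
    (u : 'rV[R]_n -> R) (u_C2 : C2 u)
    (lam : 'rV[R]_n -> 'I_n -> R)
    (lamE : forall x, eigenvalues_of (hessian u x) (lam x))
    (lam_neq : forall x i, lam x i <> - (a + b))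
    (u_eq : forall x,
       phase a b (lam x) = - u x + 1 / 2 * inner x (gradient u x)) :
  quadratic_polynomial u /\
  exists (A : 'M[R]_n) (lbar : 'I_n -> R),
    [/\ A^T = A,
        eigenvalues_of A lbar,
        forall i, lbar i <> - (a + b) &
        forall x, u x = - phase a b lbar + 1 / 2 * inner x (x *m A^T)].
Proof.
have b0 : 0 < b.
  have /andP[c0 c1] := cot_lt1 tau_gt tau_lt.
  by rewrite bE sqrtr_gt0 subr_gt0 expr_lt1 // ltW.
pose k := Num.sqrt (a ^+ 2 + 1) / b.
have k0 : 0 < k by rewrite divr_gt0 // sqrtr_gt0 ltr_wpDl ?sqr_ge0.
have [C [fC fg _ gC gpos]] := scaled_atan_bounds a k0 b0.
have speed0 : forall x, dilation_speed u x = dilation_speed u 0.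
  pose c0 := k * (pi * (\sum_i pole_side a b (lam 0%R i))%:R - n%:R * (pi / 4)).
  have trE x : \sum_i k * atan ((lam x i + a) / b) = dilation_speed u x - c0.
    rewrite /c0 -(pole_count_constant b0 u_C2 lamE lam_neq u_eq x).
    by rewrite /dilation_speed -u_eq phaseE // -/k addrK.
  apply: (constant_speed u_C2 fC fg _ _ gpos lamE trE) => x.
    by have /andP[] := gC x.
  by have /andP[] := gC x.
have uE := quadratic_of_constant_speed u_C2 speed0.
split; first exact: quadratic_polynomial_form uE.
exists (hessian u 0), (lam 0); split=> // [|x]; first exact: hessian_symmetric.
rewrite hessian_symmetric // u_eq inner0l mulr0 addr0 opprK; exact: uE.
Qed.
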